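(* The functor $F \colon \mathbf{Cstar} \to \mathbf{Cstar}$ given by $$F(A) = \operatorname{colim}_{C \in \mathcal{C}(A)} \; A *_C \ell^\infty(\mathrm{Spec}(C)),$$ equipped with the naturally induced $*$-homomorphisms $\eta_A \colon A \to F(A)$, has the following properties. (a) $(F,\eta)$ is a functorial C*-discretization. (b) For each C*-algebra $A$, the C*-discretization $\eta_A \colon A \to F(A)$ is universal among all compatible C*-discretizations of $A$: every compatible C*-discretization $\phi \colon A \to M$ factors uniquely through $\eta_A$, that is, there is a unique $*$-homomorphism $\psi \colon F(A) \to M$ with $\psi \circ \eta_A = \phi$. (c) Thus $F$ is universal among all functorial C*-discretizations: for every functorial C*-discretization $(F',\eta')$ there is a unique natural transformation $\theta \colon F \Rightarrow F'$ whose composite with $\eta$ is $\eta'$, that is, $\theta_A \circ \eta_A = \eta'_A$ for all C*-algebras $A$.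
   Context: All algebras and subalgebras are unital and all homomorphisms preserve units. $\mathbf{Cstar}$ is the category of C*-algebras with $*$-homomorphisms, and $\mathbf{cCstar}$ is its full subcategory of commutative C*-algebras. For a commutative C*-algebra $C$, $\mathrm{Spec}(C)$ is its Gelfand spectrum; $\ell^\infty(X)$ is the algebra of bounded complex-valued functions on the set $X$; the natural inclusion $C \to \ell^\infty(\mathrm{Spec}(C))$ is the Gelfand isomorphism $C \simeq C(\mathrm{Spec}(C))$ followed by the inclusion of continuous functions into bounded functions. A $*$-homomorphism $C \to D$ of commutative C*-algebras induces a $*$-homomorphism $\ell^\infty(\mathrm{Spec}(C)) \to \ell^\infty(\mathrm{Spec}(D))$ by precomposition with the dual map $\mathrm{Spec}(D)\to\mathrm{Spec}(C)$, giving a functor $L = \ell^\infty\circ\mathrm{Spec}\colon \mathbf{cCstar}\to\mathbf{Cstar}$. $\mathcal{C}(A)$ is the category (partially ordered set) of commutative C*-subalgebras of $A$ with inclusion morphisms. $A *_C L(C)$ is the pushout (amalgamated free product) in $\mathbf{Cstar}$ of the inclusions $C \to A$ and $C \to L(C)$; it is functorial in $C \in \mathcal{C}(A)$, and the colimit defining $F(A)$ is taken in $\mathbf{Cstar}$. The map $\eta_A$ is the composite $A \to A *_C L(C) \to F(A)$, which is the same for all $C \in \mathcal{C}(A)$. For a $*$-homomorphism $f\colon A \to B$, $F(f)$ is induced by $C \mapsto f(C)$, $\mathcal{C}(A) \to \mathcal{C}(B)$, together with $f$ and the maps $L(C) \to L(f(C))$. A C*-discretization of $A$ is a homomorphism $\phi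 \colon A \to M$ to a C*-algebra $M$ whose restriction to each commutative C*-subalgebra $C$ of $A$ factors through the natural inclusion $C \to L(C)$ via a $*$-homomorphism $\phi_C \colon L(C) \to M$. It is compatible if the $\phi_C$ can be chosen such that, for all commutative C*-subalgebras $C \subseteq D \subseteq A$, $\phi_C$ equals the composite of the induced morphism $L(C) \to L(D)$ with $\phi_D$. A functorial C*-discretization is a functor $F \colon \mathbf{Cstar} \to \mathbf{Cstar}$ together with homomorphisms $\eta_A \colon A \to F(A)$, natural in $A$, such that there is an isomorphism $F(C) \simeq \ell^\infty(\mathrm{Spec}(C))$, natural in the commutative C*-algebra $C$, which turns $\eta_C$ into the natural inclusion $C \to \ell^\infty(\mathrm{Spec}(C))$.
   Formalization: In (b), ψ is proved to exist for each compatible φ, but is unique only given the compatible family φ_C (ψ must also restrict to φ_C on each L(C)); uniqueness from ψ∘η_A = φ alone fails, e.g. for evaluation at 0 on C([0,1]), which has several extensions to ℓ^∞([0,1]). *)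

(* Defs.v *)
From HB Require Import structures.
From mathcomp Require Import all_boot all_order all_algebra.
From mathcomp Require Import complex.
From mathcomp Require Import boolp classical_sets functions reals.
From mathcomp Require Import topology normedtype sequences.

Set Implicit Arguments.
Unset Strict Implicit.
Unset Printing Implicit Defensive.

Import Order.TTheory GRing.Theory Num.Theory.
Import numFieldNormedType.Exports.

Local Open Scope classical_set_scope.
Local Open Scope ring_scope.
Local Open Scope complex_scope.

(* All C*-algebras are unital; the zero algebra (in which 1 = 0) is allowed,
   as Cstar would not have all colimits without it.  The ring structure is
   given by fields because the library has no join of pzRingType with
   normedModType; it is made canonical just below. *)
Record cstarAlgType (R : realType) := CstarAlgType {
  cstar_base : completeNormedModType R[i];
  cstar_mul : cstar_base -> cstar_base -> cstar_base;
  cstar_one : cstar_base;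
  star : cstar_base -> cstar_base;
  cstar_mulA : associative cstar_mul;
  cstar_mul1 : left_id cstar_one cstar_mul;
  cstar_mulr1 : right_id cstar_one cstar_mul;
  cstar_mulDl : left_distributive cstar_mul +%R;
  cstar_mulDr : right_distributive cstar_mul +%R;
  cstar_scaleAl : forall (k : R[i]) (x y : cstar_base),
    k *: cstar_mul x y = cstar_mul (k *: x) y;
  cstar_scaleAr : forall (k : R[i]) (x y : cstar_base),
    k *: cstar_mul x y = cstar_mul x (k *: y);
  starK : involutive star;
  starD : {morph star : x y / x + y};
  starZ : forall (k : R[i]) (x : cstar_base), star (k *: x) = conjc k *: star x;
  starM : forall x y : cstar_base,
    star (cstar_mul x y) = cstar_mul (star y) (star x);
  cstar_normM : forall x y : cstar_base, `|cstar_mul x y| <= `|x| * `|y|;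
  cstar_norm : forall x : cstar_base, `|cstar_mul (star x) x| = `|x| ^+ 2
}.

Definition cstar_sort (R : realType) (A : cstarAlgType R) : Type :=
  cstar_base A.
Coercion cstar_sort : cstarAlgType >-> Sortclass.

HB.instance Definition _ (R : realType) (A : cstarAlgType R) :=
  CompleteNormedModule.copy (cstar_sort A) (cstar_base A).
HB.instance Definition _ (R : realType) (A : cstarAlgType R) :=
  GRing.Zmodule_isPzRing.Build (cstar_sort A)
    (@cstar_mulA R A) (@cstar_mul1 R A) (@cstar_mulr1 R A)
    (@cstar_mulDl R A) (@cstar_mulDr R A).

Record starHom (R : realType) (A B : cstarAlgType R) := StarHom {
  starHom_fun :> A -> B;
  starHom_linear : linear starHom_fun;
  starHom_monoid : monoid_morphism starHom_fun;
  starHom_star : {morph starHom_fun : x / star x}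
}.

HB.instance Definition _ (R : realType) (A B : cstarAlgType R)
    (f : starHom A B) :=
  GRing.isLinear.Build R[i] A B *:%R f (starHom_linear f).
HB.instance Definition _ (R : realType) (A B : cstarAlgType R)
    (f : starHom A B) :=
  GRing.isMonoidMorphism.Build A B f (starHom_monoid f).

Definition cabs (R : realType) (z : R[i]) : R := complex.Re `|z|.

Lemma cabsE (R : realType) (z : R[i]) : (cabs z)%:C = `|z|.
Proof. by rewrite /cabs RRe_real// normr_real. Qed.

Lemma complex_gt0P (R : realType) (e : R[i]) :
  0 < e -> exists2 r : R, 0 < r & e = r%:C.
Proof. by case: e => a b; rewrite ltcE/= => /andP[/eqP -> a0]; exists a. Qed.

Lemma invS_lt (R : realType) (e : R) :
  0 < e -> exists N, forall n, (N <= n)%N -> n.+1%:R^-1 < e.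
Proof.
move=> e0; exists (Num.truncn e^-1) => n Nn.
rewrite -[e]invrK ltf_pV2 ?posrE ?invr_gt0 ?ltr0n//.
by apply: lt_le_trans (truncnS_gt _) _; rewrite ler_nat.
Qed.

Lemma seq_complete (R : realType) (V : normedModType R[i]) :
  (forall u : nat -> V,
     (forall e : R, 0 < e -> exists N, forall m n, (N <= m)%N -> (N <= n)%N ->
        `|u m - u n| < e%:C) ->
     exists l, forall e : R, 0 < e -> exists N, forall n, (N <= n)%N ->
        `|u n - l| < e%:C) ->
  forall F : set_system V, ProperFilter F -> cauchy F -> cvg F.
Proof.
move=> V_complete F FF /cauchyP F_cauchy.
have [x_ Fx_] : {x_ : nat -> V & forall n, F (ball (x_ n) (n.+1%:R^-1)%:C)}.
  apply: (boolp.choice (P := fun n x => F (ball x (n.+1%:R^-1)%:C))) => n.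
  by apply: F_cauchy; rewrite ltcR invr_gt0 ltr0n.
have [e e0|l lP] := V_complete x_.
  have [N NP] := invS_lt (divr_gt0 e0 (ltr0Sn R 1)).
  exists N => m n Nm Nn.
  have [y []] := filter_ex (filterI (Fx_ m) (Fx_ n)).
  rewrite -!ball_normE /= => ym yn.
  rewrite (splitr e) rmorphD/=.
  apply: le_lt_trans (ler_distD y _ _) _; rewrite [in X in _ + X]distrC.
  by apply: ltrD; [apply: lt_trans ym _|apply: lt_trans yn _];
    rewrite ltcR; apply: NP.
apply/cvg_ex; exists l; apply/cvgrPdist_lt => _ /complex_gt0P[e e0 ->].
have [N1 N1P] := lP _ (divr_gt0 e0 (ltr0Sn R 1)).
have [N2 N2P] := invS_lt (divr_gt0 e0 (ltr0Sn R 1)).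
pose n := maxn N1 N2.
apply: filterS (Fx_ n) => y; rewrite -ball_normE /= => yn.
rewrite (splitr e) rmorphD/=.
apply: le_lt_trans (ler_distD (x_ n) _ _) _; rewrite [in X in X + _]distrC.
apply: ltrD; first by apply: N1P; rewrite leq_maxl.
by apply: lt_trans yn _; rewrite ltcR N2P// leq_maxr.
Qed.

HB.factory Record Lmodule_isCompleteNormed (R : realType) V
    & GRing.Lmodule R[i] V := {
  rnorm : V -> R;
  rnormD : forall x y, rnorm (x + y) <= rnorm x + rnorm y;
  rnormZ : forall (k : R[i]) x, (rnorm (k *: x))%:C = `|k| * (rnorm x)%:C;
  rnorm0_eq0 : forall x, rnorm x = 0 -> x = 0;
  rnorm_complete : forall u : nat -> V,
    (forall e : R, 0 < e -> exists N, forall m n, (N <= m)%N -> (N <= n)%N ->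
       rnorm (u m - u n) < e) ->
    exists l, forall e : R, 0 < e -> exists N, forall n, (N <= n)%N ->
       rnorm (u n - l) < e
}.

HB.builders Context R V & Lmodule_isCompleteNormed R V.

Let cnorm (x : V) : R[i] := (rnorm x)%:C.

Let cnormD x y : cnorm (x + y) <= cnorm x + cnorm y.
Proof. by rewrite -rmorphD lecR rnormD. Qed.

Let cnorm0_eq0 x : cnorm x = 0 -> x = 0.
Proof. by move/complexI; apply: rnorm0_eq0. Qed.

HB.instance Definition _ :=
  Lmodule_isNormed.Build R[i] V cnormD rnormZ cnorm0_eq0.

Let cauchy_cvg (F : set_system V) : ProperFilter F -> cauchy F -> cvg F.
Proof.
apply: seq_complete => u u_cauchy.
have [e e0|l lP] := @rnorm_complete u.
  have [N NP] := u_cauchy e e0.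
  by exists N => m n Nm Nn; rewrite -ltcR; apply: NP.
exists l => e e0; have [N NP] := lP e e0.
by exists N => n Nn; have := NP n Nn; rewrite -ltcR.
Qed.

HB.instance Definition _ := Uniform_isComplete.Build V cauchy_cvg.

HB.end.

Lemma cabs_ge0 (R : realType) (z : R[i]) : 0 <= cabs z.
Proof. by rewrite -lecR cabsE; apply: normr_ge0. Qed.

Lemma cabsD (R : realType) (z w : R[i]) : cabs (z + w) <= cabs z + cabs w.
Proof. by rewrite -lecR rmorphD /= !cabsE ler_normD. Qed.

Lemma cabsM (R : realType) (z w : R[i]) : cabs (z * w) = cabs z * cabs w.
Proof. by apply: complexI; rewrite rmorphM /= !cabsE normrM. Qed.

Lemma cabsB (R : realType) (z w : R[i]) : cabs (z - w) = cabs (w - z).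
Proof. by rewrite /cabs distrC. Qed.

Lemma cabs_conj (R : realType) (z : R[i]) : cabs (conjc z) = cabs z.
Proof. by rewrite /cabs normcJ. Qed.

Lemma cabs_ReIm (R : realType) (z : R[i]) :
  [/\ `|complex.Re z| <= cabs z, `|complex.Im z| <= cabs z
    & cabs z <= `|complex.Re z| + `|complex.Im z|].
Proof.
have cabsz : cabs z = Num.sqrt (complex.Re z ^+ 2 + complex.Im z ^+ 2).
  by rewrite /cabs normc_def.
rewrite cabsz -!sqrtr_sqr; split.
- by rewrite ler_wsqrtr// lerDl sqr_ge0.
- by rewrite ler_wsqrtr// lerDr sqr_ge0.
- rewrite -(ler_pXn2r (n := 2))// ?nnegrE ?addr_ge0 ?sqrtr_ge0//.
  rewrite sqrrD !sqr_sqrtr ?addr_ge0 ?sqr_ge0//.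
  by rewrite addrAC lerDl mulrn_wge0// mulr_ge0 ?sqrtr_ge0.
Qed.

Lemma real_seq_complete (R : realType) (u : nat -> R) :
  (forall e : R, 0 < e -> exists N, forall m n, (N <= m)%N -> (N <= n)%N ->
     `|u m - u n| < e) ->
  exists l, forall e : R, 0 < e -> exists N, forall n, (N <= n)%N ->
     `|u n - l| < e.
Proof.
move=> u_cauchy.
have /cvg_ex[l ul] : cvg (u @ \oo).
  apply: cauchy_cvg; apply: cauchy_exP => e e0.
  have [N NP] := u_cauchy e e0; exists (u N).
  by exists N => // n /= Nn; rewrite -ball_normE /=; apply: NP.
exists l => e e0; move/cvgrPdist_lt: ul => /(_ e e0)[N _ NP].
by exists N => n Nn; rewrite distrC; apply: NP.
Qed.

Lemma complex_seq_complete (R : realType) (u : nat -> R[i]) :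
  (forall e : R, 0 < e -> exists N, forall m n, (N <= m)%N -> (N <= n)%N ->
     cabs (u m - u n) < e) ->
  exists l, forall e : R, 0 < e -> exists N, forall n, (N <= n)%N ->
     cabs (u n - l) < e.
Proof.
move=> u_cauchy.
have [e e0|a aP] := @real_seq_complete R (fun n => complex.Re (u n)).
  have [N NP] := u_cauchy e e0; exists N => m n Nm Nn.
  have [+ _ _] := cabs_ReIm (u m - u n); rewrite raddfB/=.
  by move=> /le_lt_trans; apply; apply: NP.
have [e e0|b bP] := @real_seq_complete R (fun n => complex.Im (u n)).
  have [N NP] := u_cauchy e e0; exists N => m n Nm Nn.
  have [_ + _] := cabs_ReIm (u m - u n); rewrite raddfB/=.
  by move=> /le_lt_trans; apply; apply: NP.
exists (Complex a b) => e e0.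
have [N1 N1P] := aP _ (divr_gt0 e0 (ltr0Sn R 1)).
have [N2 N2P] := bP _ (divr_gt0 e0 (ltr0Sn R 1)).
exists (maxn N1 N2) => n; rewrite geq_max => /andP[n1 n2].
have [_ _] := cabs_ReIm (u n - Complex a b).
move=> /le_lt_trans; apply; rewrite !raddfB/= (splitr e).
by rewrite ltrD ?N1P ?N2P.
Qed.

Section BoundedFunctions.
Context (R : realType) (X : Type).

Definition bounded_fct : {pred X -> R[i]} :=
  fun f => `[< exists M : R, forall x, `|f x| <= M%:C >].

Lemma bounded_fctP (f : X -> R[i]) :
  reflect (exists M : R, forall x, `|f x| <= M%:C) (f \in bounded_fct).
Proof. exact: asboolP. Qed.

Fact bounded_fct_subring : subring_closed bounded_fct.
Proof.
split=> [|f g /bounded_fctP[M fM] /bounded_fctP[N gN]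
         |f g /bounded_fctP[M fM] /bounded_fctP[N gN]]; apply/bounded_fctP.
- by exists 1 => x; rewrite /GRing.one /= normr1.
- exists (M + N) => x; rewrite rmorphD; apply: le_trans (ler_normB _ _) _.
  exact: lerD.
- exists (M * N) => x; rewrite rmorphM/= normrM; exact: ler_pM.
Qed.
HB.instance Definition _ := GRing.isSubringClosed.Build (X -> R[i]) bounded_fct
  bounded_fct_subring.

Fact bounded_fct_scale : scaler_closed bounded_fct.
Proof.
move=> k f /bounded_fctP[M fM]; apply/bounded_fctP.
exists (cabs k * M) => x; rewrite normrM rmorphM /= cabsE.
exact: ler_wpM2l.
Qed.
HB.instance Definition _ := GRing.isScaleClosed.Build R[i] (X -> R[i])
  bounded_fct bounded_fct_scale.

Record linf := Linf { linf_fun :> X -> R[i]; _ : linf_fun \in bounded_fct }.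
HB.instance Definition _ := [isSub for linf_fun].
HB.instance Definition _ := [Choice of linf by <:].
HB.instance Definition _ := 
  GRing.SubChoice_isSubPzRing.Build (X -> R[i]) bounded_fct linf
    bounded_fct_subring.
HB.instance Definition _ := [SubZmodule_isSubLmodule of linf by <:].

Implicit Types f g : linf.

Lemma linf_boundedP f : exists M : R, forall x, `|f x| <= M%:C.
Proof. by case: f => f /= /bounded_fctP. Qed.

Definition sup_norm f : R := sup (range (fun x => cabs (f x))).

Lemma sup_norm_ub f x : cabs (f x) <= sup_norm f.
Proof.
apply: ub_le_sup; last by exists x.
have [M fM] := linf_boundedP f.
by exists M => _ [y _ <-]; rewrite -lecR cabsE.
Qed.

Lemma sup_norm_ge0 f : 0 <= sup_norm f.
Proof.
have [x|X0] := pselect (exists x : X, True).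
  by case: x => x _; apply: le_trans (sup_norm_ub f x); apply: cabs_ge0.
rewrite /sup_norm sup_out//; case=> [[_ [x _ _]] _]; by apply: X0; exists x.
Qed.

Lemma sup_norm_le f (M : R) :
  0 <= M -> (forall x, cabs (f x) <= M) -> sup_norm f <= M.
Proof.
move=> M0 fM; have [[x _]|X0] := pselect (exists x : X, True).
  by apply: ge_sup => [|_ [y _ <-]//]; exists (cabs (f x)), x.
rewrite /sup_norm sup_out//; case=> [[_ [x _ _]] _]; by apply: X0; exists x.
Qed.

Lemma linfD f g x : (f + g) x = f x + g x. Proof. by []. Qed.
Lemma linfB f g x : (f - g) x = f x - g x. Proof. by []. Qed.
Lemma linfM f g x : (f * g) x = f x * g x. Proof. by []. Qed.
Lemma linfZ (k : R[i]) f x : (k *: f) x = k * f x. Proof. by []. Qed.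
Lemma linf1 x : (1 : linf) x = 1. Proof. by []. Qed.
Lemma linfP f g : f =1 g -> f = g.
Proof. by move=> fg; apply/val_inj/funext. Qed.

Let sup_normD f g : sup_norm (f + g) <= sup_norm f + sup_norm g.
Proof.
apply: sup_norm_le => [|x]; first by rewrite addr_ge0 ?sup_norm_ge0.
rewrite linfD; apply: le_trans (cabsD _ _) _.
by rewrite lerD ?sup_norm_ub.
Qed.

Let sup_norm_cabsZ (k : R[i]) f : sup_norm (k *: f) <= cabs k * sup_norm f.
Proof.
apply: sup_norm_le => [|x]; first by rewrite mulr_ge0 ?sup_norm_ge0 ?cabs_ge0.
by rewrite linfZ cabsM ler_wpM2l ?cabs_ge0 ?sup_norm_ub.
Qed.

Let sup_normZ (k : R[i]) f :
  (sup_norm (k *: f))%:C = `|k| * (sup_norm f)%:C.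
Proof.
rewrite -cabsE -rmorphM /=; congr (_%:C); apply/eqP.
rewrite eq_le sup_norm_cabsZ /=.
have [->|k0] := eqVneq k 0.
  by rewrite /cabs normr0 /= mul0r sup_norm_ge0.
have ak0 : 0 < cabs k by rewrite -ltcR cabsE normr_gt0.
rewrite -ler_pdivlMl//.
have -> : (cabs k)^-1 = cabs k^-1.
  by apply: complexI; rewrite fmorphV /= !cabsE normfV.
by rewrite -[X in sup_norm X](scalerK k0) sup_norm_cabsZ.
Qed.

Let sup_norm0_eq0 f : sup_norm f = 0 -> f = 0.
Proof.
move=> f0; apply: linfP => x; apply/eqP; rewrite -normr_eq0 -cabsE.
have := sup_norm_ub f x; rewrite f0 => fx0.
have -> : cabs (f x) = 0 by apply/eqP; rewrite eq_le fx0 cabs_ge0.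
by [].
Qed.

Let sup_norm_complete (u : nat -> linf) :
  (forall e : R, 0 < e -> exists N, forall m n, (N <= m)%N -> (N <= n)%N ->
     sup_norm (u m - u n) < e) ->
  exists l, forall e : R, 0 < e -> exists N, forall n, (N <= n)%N ->
     sup_norm (u n - l) < e.
Proof.
move=> u_cauchy.
have [g gP] : {g : X -> R[i] & forall x, forall e : R, 0 < e ->
    exists N, forall n, (N <= n)%N -> cabs (u n x - g x) < e}.
  apply: (boolp.choice (P := fun x l => forall e : R, 0 < e ->
    exists N, forall n, (N <= n)%N -> cabs (u n x - l) < e)) => x.
  apply: complex_seq_complete => e e0.
  have [N NP] := u_cauchy e e0; exists N => m n Nm Nn.
  by apply: le_lt_trans (NP m n Nm Nn); rewrite -linfB sup_norm_ub.
have ug (e : R) : 0 < e -> exists N, forall n, (N <= n)%N ->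
    forall x, cabs (u n x - g x) <= e.
  move=> e0; have [N NP] := u_cauchy _ (divr_gt0 e0 (ltr0Sn R 1)).
  exists N => n Nn x.
  have [N' N'P] := gP x _ (divr_gt0 e0 (ltr0Sn R 1)).
  rewrite -(subrKA (u (maxn N N') x)).
  apply: le_trans (cabsD _ _) _; rewrite (splitr e) lerD//.
    apply: ltW; apply: le_lt_trans (NP n (maxn N N') Nn (leq_maxl _ _)).
    by rewrite -linfB sup_norm_ub.
  by rewrite ltW// N'P// leq_maxr.
have g_bounded : g \in bounded_fct.
  apply/bounded_fctP; have [N NP] := ug 1 ltr01.
  exists (1 + sup_norm (u N)) => x; rewrite -cabsE lecR.
  rewrite -[g x](subrK (u N x)); apply: le_trans (cabsD _ _) _.
  by rewrite lerD ?sup_norm_ub// cabsB NP.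
exists (Linf g_bounded) => e e0.
have [N NP] := ug _ (divr_gt0 e0 (ltr0Sn R 1)); exists N => n Nn.
apply: le_lt_trans (_ : e / 2 < e); last first.
  by rewrite ltr_pdivrMr// ltr_pMr// ltr1n.
by apply: sup_norm_le => [|x]; [rewrite divr_ge0// ltW|rewrite linfB NP].
Qed.

HB.instance Definition _ := Lmodule_isCompleteNormed.Build R linf
  sup_normD sup_normZ sup_norm0_eq0 sup_norm_complete.

Let linf_star_subproof f : (fun x => conjc (f x)) \in bounded_fct.
Proof.
apply/bounded_fctP; have [M fM] := linf_boundedP f.
by exists M => x; rewrite normcJ.
Qed.
Definition linf_star f : linf := Linf (linf_star_subproof f).

Let linf_normE f : `|f| = (sup_norm f)%:C. Proof. by []. Qed.

Fact linf_starK : involutive linf_star.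
Proof. by move=> f; apply: linfP => x /=; rewrite conjcK. Qed.
Fact linf_starD : {morph linf_star : f g / f + g}.
Proof. by move=> f g; apply: linfP => x /=; rewrite rmorphD. Qed.
Fact linf_starZ (k : R[i]) f : linf_star (k *: f) = conjc k *: linf_star f.
Proof. by apply: linfP => x; apply: rmorphM. Qed.
Fact linf_starM f g : linf_star (f * g) = linf_star g * linf_star f.
Proof. by apply: linfP => x /=; rewrite rmorphM mulrC. Qed.
Fact linf_scaleAl (k : R[i]) f g : k *: (f * g) = k *: f * g.
Proof. by apply: linfP => x; exact: mulrA. Qed.
Fact linf_scaleAr (k : R[i]) f g : k *: (f * g) = f * (k *: g).
Proof. by apply: linfP => x; exact: mulrCA. Qed.
Fact linf_normM f g : `|f * g| <= `|f| * `|g|.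
Proof.
rewrite !linf_normE -rmorphM lecR; apply: sup_norm_le => [|x].
  by rewrite mulr_ge0 ?sup_norm_ge0.
by rewrite linfM cabsM ler_pM ?cabs_ge0 ?sup_norm_ub.
Qed.
Fact linf_norm_star f : `|linf_star f * f| = `|f| ^+ 2.
Proof.
rewrite !linf_normE -rmorphXn; congr (_%:C); apply/eqP; rewrite eq_le.
apply/andP; split.
  apply: sup_norm_le => [|x]; first by rewrite exprn_ge0 ?sup_norm_ge0.
  by rewrite linfM cabsM /= cabs_conj expr2 ler_pM ?cabs_ge0 ?sup_norm_ub.
have [s0|s0] := eqVneq (sup_norm f) 0.
  by rewrite s0 expr0n sup_norm_ge0.
rewrite -[X in _ <= X]sqr_sqrtr ?sup_norm_ge0//.
rewrite ler_pXn2r ?nnegrE ?sqrtr_ge0 ?sup_norm_ge0//.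
apply: sup_norm_le => [|x]; first by rewrite sqrtr_ge0.
rewrite -[cabs _]ger0_norm ?cabs_ge0// -sqrtr_sqr ler_wsqrtr//.
rewrite expr2 -{1}cabs_conj -cabsM -[_ * _]/((linf_star f * f) x).
exact: sup_norm_ub.
Qed.

Definition linf_cstar : cstarAlgType R :=
  @CstarAlgType R linf *%R 1 linf_star (@mulrA linf) (@mul1r linf)
    (@mulr1 linf) (@mulrDl linf) (@mulrDr linf) linf_scaleAl linf_scaleAr
    linf_starK linf_starD linf_starZ linf_starM linf_normM linf_norm_star.

End BoundedFunctions.

Lemma complete_seq_cvg (R : realType) (V : completeNormedModType R[i])
    (u : nat -> V) :
  (forall e : R, 0 < e -> exists N, forall m n, (N <= m)%N -> (N <= n)%N ->
     `|u m - u n| < e%:C) ->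
  exists2 l, u @ \oo --> l & forall e : R, 0 < e ->
    exists N, forall n, (N <= n)%N -> `|u n - l| < e%:C.
Proof.
move=> u_cauchy.
have /cvg_ex[l ul] : cvg (u @ \oo).
  apply: cauchy_cvg; apply: cauchy_exP => _ /complex_gt0P[e e0 ->].
  have [N NP] := u_cauchy e e0; exists (u N).
  by exists N => // n /= Nn; rewrite -ball_normE /=; apply: NP.
exists l => // e e0.
have e0' : 0 < e%:C by rewrite ltcR.
move/cvgrPdist_lt: ul => /(_ _ e0')[N _ NP].
by exists N => n Nn; rewrite distrC; apply: NP.
Qed.

Definition rnormr (R : realType) (V : normedModType R[i]) (x : V) : R :=
  complex.Re `|x|.

Lemma rnormrE (R : realType) (V : normedModType R[i]) (x : V) :
  (rnormr x)%:C = `|x|.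
Proof. by rewrite /rnormr RRe_real// normr_real. Qed.

Lemma rnormr_ge0 (R : realType) (V : normedModType R[i]) (x : V) :
  0 <= rnormr x.
Proof. by rewrite -lecR rnormrE; apply: normr_ge0. Qed.

Section Spectrum.
Context (R : realType) (C : cstarAlgType R).

(* The Gelfand spectrum of C, as the set of unital *-homomorphisms C -> R[i].
   It is only used for commutative C.  Its topology plays no role here: only
   bounded functions on the underlying set are needed. *)
Record spectrum := Character {
  char_fun :> C -> R[i];
  char_linear : scalar char_fun;
  char_monoid : monoid_morphism char_fun;
  char_star : forall x, char_fun (star x) = conjc (char_fun x)
}.

HB.instance Definition _ (chi : spectrum) :=
  GRing.isLinear.Build R[i] C R[i] *%R chi (char_linear chi).
HB.instance Definition _ (chi : spectrum) :=
  GRing.isMonoidMorphism.Build C R[i] chi (char_monoid chi).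

Lemma charZ (chi : spectrum) (k : R[i]) (x : C) : chi (k *: x) = k * chi x.
Proof. by have := char_linear chi k x 0; rewrite addr0 raddf0 addr0. Qed.

Lemma cstar_fixpoint (b : C) : `|b| < 1 -> exists y : C, y = 1 + b * y.
Proof.
rewrite -rnormrE -[1]/((1 : R)%:C) ltcR; set r := rnormr b => r1.
have r0 : 0 <= r := rnormr_ge0 _.
pose y n := iter n (fun y : C => 1 + b * y) 0.
pose M := rnormr (1 : C) / (1 - r).
have r1' : 0 < 1 - r by rewrite subr_gt0.
have M0 : 0 <= M by rewrite divr_ge0 ?rnormr_ge0// ltW.
have yM k : `|y k| <= M%:C.
  elim: k => [|k IHk]; first by rewrite normr0 lecR.
  apply: le_trans (ler_normD _ _) _; rewrite -rnormrE.
  apply: (@le_trans _ _ ((rnormr (1 : C))%:C + (r * M)%:C)).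
    rewrite lerD2l rmorphM /= rnormrE; apply: le_trans (cstar_normM _ _) _.
    by rewrite ler_wpM2l.
  rewrite -rmorphD lecR.
  have <- : M - r * M = rnormr (1 : C).
    by rewrite -[X in X - _]mul1r -mulrBl mulrC divfK// gt_eqF.
  by rewrite subrK.
have yS n : y n.+1 = 1 + b * y n by [].
have fB (x z : C) : 1 + b * x - (1 + b * z) = b * (x - z).
  by rewrite opprD addrACA subrr add0r -mulrBr.
have yB n k : `|y (n + k)%N - y n| <= (r ^+ n * M)%:C.
  elim: n => [|n IHn]; first by rewrite subr0 mul1r add0n.
  rewrite addSn !yS fB exprS -mulrA rmorphM/= rnormrE.
  apply: le_trans (cstar_normM _ _) _; exact: ler_wpM2l.
have rM (e : R) : 0 < e -> exists N, r ^+ N * M < e.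
  move=> e0.
  have /cvgrPdist_lt /(_ e e0)[N _ /(_ N (leqnn _))] :
      (fun n => r ^+ n * M) @ \oo --> (0 * M : R).
    by apply: cvgMl; apply: cvg_expr; rewrite ger0_norm.
  rewrite /= mul0r sub0r normrN.
  by rewrite ger0_norm ?(mulr_ge0 (exprn_ge0 _ r0) M0)//; exists N.
have [e e0|l _ lP] := @complete_seq_cvg R C y.
  have [N NP] := rM _ (divr_gt0 e0 (ltr0Sn R 1)); exists N => m n Nm Nn.
  apply: le_lt_trans (ler_distD (y N) _ _) _; rewrite (splitr e) rmorphD/=.
  rewrite [in X in _ + X]distrC -(subnKC Nm) -(subnKC Nn).
  by apply: ltrD; apply: le_lt_trans (yB _ _) _; rewrite ltcR.
exists l; apply/eqP; rewrite -subr_eq0 -normr_eq0.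
have [//|l0] := eqVneq `|l - (1 + b * l)| 0.
have : 0 < `|l - (1 + b * l)| by rewrite lt_def l0 normr_ge0.
move=> /complex_gt0P[e e0 le].
have [N NP] := lP _ (divr_gt0 e0 (ltr0Sn R 1)).
suff : `|l - (1 + b * l)| < e%:C by rewrite le ltxx.
apply: le_lt_trans (ler_distD (y N.+1) _ _) _; rewrite (splitr e) rmorphD/=.
apply: ltrD; first by rewrite distrC; apply: (NP N.+1 (leqnSn N)).
rewrite fB; apply: le_lt_trans (cstar_normM _ _) _.
apply: le_lt_trans (NP N (leqnn _)); rewrite ler_piMl//.
by rewrite -rnormrE -[1]/((1 : R)%:C) lecR ltW.
Qed.

Lemma char_norm_le (chi : spectrum) (c : C) : `|chi c| <= `|c|.
Proof.
rewrite -cabsE -rnormrE lecR leNgt; apply/negP => c_lt.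
have chi0 : chi c != 0.
  rewrite -normr_eq0 -cabsE -[0]/((0 : R)%:C) (inj_eq (@complexI R)) gt_eqF//.
  exact: le_lt_trans (rnormr_ge0 _) c_lt.
have [|y yE] := @cstar_fixpoint ((chi c)^-1 *: c).
  rewrite normrZ normfV mulrC ltr_pdivrMr ?normr_gt0// mul1r.
  by rewrite -cabsE -rnormrE ltcR.
have := congr1 chi yE; rewrite rmorphD rmorphM rmorph1 /= charZ mulVf//.
by move/eqP; rewrite mul1r -subr_eq subrr eq_sym oner_eq0.
Qed.

Lemma gelfand_subproof (c : C) :
  (fun chi : spectrum => chi c) \in @bounded_fct R spectrum.
Proof.
by apply/bounded_fctP; exists (rnormr c) => chi; rewrite rnormrE char_norm_le.
Qed.

(* L(C), the algebra of bounded functions on the spectrum of C. *)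
Definition ell := linf_cstar R spectrum.

Definition gelfand_fun (c : C) : ell := Linf (gelfand_subproof c).

Fact gelfand_linear : linear gelfand_fun.
Proof. by move=> k x y; apply: linfP => chi; apply: char_linear. Qed.
Fact gelfand_monoid : monoid_morphism gelfand_fun.
Proof.
split; first by apply: linfP => chi; apply: rmorph1.
by move=> x y; apply: linfP => chi; apply: rmorphM.
Qed.
Fact gelfand_star : {morph gelfand_fun : x / star x}.
Proof. by move=> x; apply: linfP => chi; apply: char_star. Qed.

Definition gelfand : starHom C ell :=
  StarHom gelfand_linear gelfand_monoid gelfand_star.

End Spectrum.

Section StarHoms.
Context (R : realType).
Implicit Types A B C D : cstarAlgType R.

Definition star_id A : starHom A A :=
  @StarHom R A A id (fun _ _ _ => erefl) (conj erefl (fun _ _ => erefl))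
    (fun _ => erefl).

Section Composition.
Context A B C (g : starHom B C) (f : starHom A B).

Fact star_comp_linear : linear (g \o f).
Proof. by move=> k x y /=; rewrite !starHom_linear. Qed.
Fact star_comp_monoid : monoid_morphism (g \o f).
Proof. by split=> [|x y] /=; rewrite ?rmorph1 ?rmorphM. Qed.
Fact star_comp_star : {morph g \o f : x / star x}.
Proof. by move=> x /=; rewrite !starHom_star. Qed.

Definition star_comp : starHom A C :=
  StarHom star_comp_linear star_comp_monoid star_comp_star.
End Composition.

Definition is_star_iso A B (f : starHom A B) :=
  exists g : starHom B A, cancel f g /\ cancel g f.

Section SpectrumMap.
Context C D (f : starHom C D).

Section Precomposition.
Context (chi : spectrum D).
Fact char_comp_linear : scalar (chi \o f).
Proof. by move=> k x y /=; rewrite starHom_linear char_linear. Qed.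
Fact char_comp_monoid : monoid_morphism (chi \o f).
Proof. by split=> [|x y] /=; rewrite ?rmorph1 ?rmorphM. Qed.
Fact char_comp_star x : (chi \o f) (star x) = conjc ((chi \o f) x).
Proof. by rewrite /= starHom_star char_star. Qed.
Definition spectrum_map : spectrum C :=
  Character char_comp_linear char_comp_monoid char_comp_star.
End Precomposition.

Fact ell_map_subproof (g : ell C) :
  g \o spectrum_map \in @bounded_fct R (spectrum D).
Proof.
have [M gM] := linf_boundedP g.
by apply/bounded_fctP; exists M => chi; apply: gM.
Qed.
Definition ell_map_fun (g : ell C) : ell D := Linf (ell_map_subproof g).

Fact ell_map_linear : linear ell_map_fun.
Proof. by move=> k g h; apply: linfP. Qed.
Fact ell_map_monoid : monoid_morphism ell_map_fun.
Proof. by split=> [|g h]; apply: linfP. Qed.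
Fact ell_map_star : {morph ell_map_fun : g / star g}.
Proof. by move=> g; apply: linfP. Qed.

Definition ell_map : starHom (ell C) (ell D) :=
  StarHom ell_map_linear ell_map_monoid ell_map_star.
End SpectrumMap.

End StarHoms.

Record comSubalg (R : realType) (A : cstarAlgType R) := ComSubalg {
  csub_set : set A;
  csub_1 : csub_set 1;
  csub_D : forall x y, csub_set x -> csub_set y -> csub_set (x + y);
  csub_Z : forall (k : R[i]) x, csub_set x -> csub_set (k *: x);
  csub_M : forall x y, csub_set x -> csub_set y -> csub_set (x * y);
  csub_star : forall x, csub_set x -> csub_set (star x);
  csub_closed : closed csub_set;
  csub_comm : forall x y, csub_set x -> csub_set y -> x * y = y * x
}.

Section SubalgebraAsAlgebra.
Context (R : realType) (A : cstarAlgType R) (S : comSubalg A).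

Definition csub_pred : {pred A} := fun x => `[< csub_set S x >].

Lemma csub_predP x : reflect (csub_set S x) (x \in csub_pred).
Proof. exact: asboolP. Qed.

Fact csub_subring : subring_closed csub_pred.
Proof.
split=> [|x y /csub_predP Sx /csub_predP Sy|x y /csub_predP Sx /csub_predP Sy];
  apply/csub_predP.
- exact: csub_1.
- by rewrite -scaleN1r; apply: csub_D => //; apply: csub_Z.
- exact: csub_M.
Qed.
HB.instance Definition _ :=
  GRing.isSubringClosed.Build A csub_pred csub_subring.

Fact csub_scale : scaler_closed csub_pred.
Proof. by move=> k x /csub_predP Sx; apply/csub_predP/csub_Z. Qed.
HB.instance Definition _ :=
  GRing.isScaleClosed.Build R[i] A csub_pred csub_scale.

Record csub := Csub { csub_val :> A; csub_valP : csub_val \in csub_pred }.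
HB.instance Definition _ := [isSub for csub_val].
HB.instance Definition _ := [Choice of csub by <:].
HB.instance Definition _ :=
  GRing.SubChoice_isSubPzRing.Build A csub_pred csub csub_subring.
HB.instance Definition _ := [SubZmodule_isSubLmodule of csub by <:].

Implicit Types x y : csub.

Lemma csubP x : csub_set S (csub_val x).
Proof. exact/csub_predP/csub_valP. Qed.
Lemma csub_inj x y : csub_val x = csub_val y -> x = y.
Proof. exact: val_inj. Qed.

Let csub_norm x : R := rnormr (csub_val x).

Let csub_normD x y : csub_norm (x + y) <= csub_norm x + csub_norm y.
Proof. by rewrite -lecR rmorphD /= !rnormrE; apply: ler_normD. Qed.
Let csub_normZ (k : R[i]) x :
  (csub_norm (k *: x))%:C = `|k| * (csub_norm x)%:C.
Proof. by rewrite !rnormrE; apply: normrZ. Qed.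
Let csub_norm0_eq0 x : csub_norm x = 0 -> x = 0.
Proof.
move=> x0; apply: csub_inj; apply/eqP; rewrite -normr_eq0 -rnormrE.
by rewrite -[rnormr _]/(csub_norm x) x0.
Qed.
Let csub_norm_complete (u : nat -> csub) :
  (forall e : R, 0 < e -> exists N, forall m n, (N <= m)%N -> (N <= n)%N ->
     csub_norm (u m - u n) < e) ->
  exists l, forall e : R, 0 < e -> exists N, forall n, (N <= n)%N ->
     csub_norm (u n - l) < e.
Proof.
move=> u_cauchy.
have [e e0|l ul lP] := @complete_seq_cvg R A (fun n => csub_val (u n)).
  have [N NP] := u_cauchy e e0; exists N => m n Nm Nn.
  by rewrite -rnormrE ltcR; apply: NP.
have Sl : l \in csub_pred.
  apply/csub_predP; apply: (closed_cvg _ (@csub_closed R A S) _ _ ul).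
  by apply: nearW => n; apply: csubP.
exists (Csub Sl) => e e0; have [N NP] := lP e e0.
by exists N => n Nn; rewrite -ltcR rnormrE; apply: NP.
Qed.

HB.instance Definition _ := Lmodule_isCompleteNormed.Build R csub
  csub_normD csub_normZ csub_norm0_eq0 csub_norm_complete.

Let csub_normE x : `|x| = `|csub_val x|.
Proof. exact: rnormrE. Qed.

Fact csub_star_subproof x : star (csub_val x) \in csub_pred.
Proof. exact/csub_predP/csub_star/csubP. Qed.
Definition csub_star_fun x : csub := Csub (csub_star_subproof x).

Fact csub_starK : involutive csub_star_fun.
Proof. by move=> x; apply/csub_inj/starK. Qed.
Fact csub_starD : {morph csub_star_fun : x y / x + y}.
Proof. by move=> x y; apply/csub_inj/starD. Qed.
Fact csub_starZ (k : R[i]) x :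
  csub_star_fun (k *: x) = conjc k *: csub_star_fun x.
Proof. exact/csub_inj/starZ. Qed.
Fact csub_starM x y :
  csub_star_fun (x * y) = csub_star_fun y * csub_star_fun x.
Proof. exact/csub_inj/starM. Qed.
Fact csub_scaleAl (k : R[i]) x y : k *: (x * y) = k *: x * y.
Proof. exact/csub_inj/cstar_scaleAl. Qed.
Fact csub_scaleAr (k : R[i]) x y : k *: (x * y) = x * (k *: y).
Proof. exact/csub_inj/cstar_scaleAr. Qed.
Fact csub_normM x y : `|x * y| <= `|x| * `|y|.
Proof. by rewrite !csub_normE; apply: cstar_normM. Qed.
Fact csub_norm_star x : `|csub_star_fun x * x| = `|x| ^+ 2.
Proof. by rewrite !csub_normE; apply: cstar_norm. Qed.

Definition csub_cstar : cstarAlgType R :=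
  @CstarAlgType R csub *%R 1 csub_star_fun (@mulrA csub) (@mul1r csub)
    (@mulr1 csub) (@mulrDl csub) (@mulrDr csub) csub_scaleAl csub_scaleAr
    csub_starK csub_starD csub_starZ csub_starM csub_normM csub_norm_star.

Definition csub_hom : starHom csub_cstar A :=
  @StarHom R csub_cstar A csub_val (fun _ _ _ => erefl)
    (conj erefl (fun _ _ => erefl)) (fun _ => erefl).

End SubalgebraAsAlgebra.
Coercion csub_cstar : comSubalg >-> cstarAlgType.

Section SubalgebraMap.
Context (R : realType) (A B : cstarAlgType R) (f : starHom A B).
Context (C : comSubalg A) (D : comSubalg B).
Hypothesis fCD : forall x, csub_set C x -> csub_set D (f x).

Fact csub_map_subproof (x : csub C) : f (csub_val x) \in csub_pred D.
Proof. exact/csub_predP/fCD/csubP. Qed.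
Definition csub_map_fun (x : csub_cstar C) : csub_cstar D :=
  Csub (csub_map_subproof x).

Fact csub_map_linear : linear csub_map_fun.
Proof. by move=> k x y; apply/csub_inj/starHom_linear. Qed.
Fact csub_map_monoid : monoid_morphism csub_map_fun.
Proof.
split; first exact/csub_inj/(rmorph1 f).
by move=> x y; apply/csub_inj/(rmorphM f).
Qed.
Fact csub_map_star : {morph csub_map_fun : x / star x}.
Proof. by move=> x; apply/csub_inj/starHom_star. Qed.

Definition csub_map : starHom (csub_cstar C) (csub_cstar D) :=
  StarHom csub_map_linear csub_map_monoid csub_map_star.
End SubalgebraMap.

Section Pushout.
Context (R : realType) (C A B P : cstarAlgType R).
Context (f : starHom C A) (g : starHom C B).
Context (i : starHom A P) (j : starHom B P).

Definition is_pushout : Prop :=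
  i \o f =1 j \o g /\
  forall (M : cstarAlgType R) (u : starHom A M) (v : starHom B M),
    u \o f =1 v \o g ->
    exists h : starHom P M, [/\ h \o i =1 u, h \o j =1 v &
      forall h' : starHom P M, h' \o i =1 u -> h' \o j =1 v -> h' =1 h].
End Pushout.

Section ColimitFormula.
Context (R : realType) (A : cstarAlgType R).
Implicit Types C D : comSubalg A.

Definition csub_incl C D (CD : csub_set C `<=` csub_set D) : starHom C D :=
  csub_map (f := star_id A) CD.

(* The diagram C |-> A *_C L(C), for some choice of the pushouts. *)
Record amalgams := Amalgams {
  amalg :> comSubalg A -> cstarAlgType R;
  amalg_l : forall C, starHom A (amalg C);
  amalg_r : forall C, starHom (ell C) (amalg C);
  amalg_pushout : forall C,
    is_pushout (csub_hom C) (gelfand C) (amalg_l C) (amalg_r C);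
  amalg_map : forall C D, csub_set C `<=` csub_set D ->
    starHom (amalg C) (amalg D);
  amalg_map_l : forall C D (CD : csub_set C `<=` csub_set D),
    amalg_map CD \o amalg_l C =1 amalg_l D;
  amalg_map_r : forall C D (CD : csub_set C `<=` csub_set D),
    amalg_map CD \o amalg_r C =1 amalg_r D \o ell_map (csub_incl CD)
}.

Definition is_cocone (P : amalgams) (Q : cstarAlgType R)
    (leg : forall C, starHom (P C) Q) : Prop :=
  forall C D (CD : csub_set C `<=` csub_set D),
    leg D \o amalg_map P CD =1 leg C.

Definition is_colimit (P : amalgams) (Q : cstarAlgType R)
    (leg : forall C, starHom (P C) Q) : Prop :=
  is_cocone leg /\
  forall (M : cstarAlgType R) (leg' : forall C, starHom (P C) M),
    is_cocone leg' ->
    exists h : starHom Q M, (forall C, h \o leg C =1 leg' C) /\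
      forall h' : starHom Q M, (forall C, h' \o leg C =1 leg' C) -> h' =1 h.

Section Discretizations.
Context (M : cstarAlgType R) (phi : starHom A M).

(* The maps phi_C form part of the data of this predicate: for a given phi
   there may be several compatible families.  For instance, if A is the algebra
   of continuous functions on [0, 1] and phi is evaluation at 0, then
   evaluation at 0 and the limit along a nonprincipal ultrafilter converging to
   0 are two maps L(A) -> R[i], which give different compatible families. *)
Definition compatible_family (phi_ : forall C, starHom (ell C) M) : Prop :=
  (forall C, phi_ C \o gelfand C =1 phi \o csub_hom C) /\
  (forall C D (CD : csub_set C `<=` csub_set D),
     phi_ C =1 phi_ D \o ell_map (csub_incl CD)).

Definition is_compatible_discretization : Prop :=
  exists phi_ : forall C, starHom (ell C) M, compatible_family phi_.
End Discretizations.

End ColimitFormula.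

Record cstarFunctor (R : realType) := CstarFunctor {
  fobj :> cstarAlgType R -> cstarAlgType R;
  fmap : forall A B, starHom A B -> starHom (fobj A) (fobj B);
  fmap_id : forall A, fmap (star_id A) =1 id;
  fmap_comp : forall A B C (g : starHom B C) (f : starHom A B),
    fmap (star_comp g f) =1 fmap g \o fmap f
}.

Definition is_natural (R : realType) (F G : cstarFunctor R)
    (theta : forall A, starHom (F A) (G A)) : Prop :=
  forall A B (f : starHom A B), theta B \o fmap F f =1 fmap G f \o theta A.

Definition is_natural_unit (R : realType) (F : cstarFunctor R)
    (eta : forall A, starHom A (F A)) : Prop :=
  forall A B (f : starHom A B), eta B \o f =1 fmap F f \o eta A.

Definition is_commutative (R : realType) (C : cstarAlgType R) : Prop :=
  forall x y : C, x * y = y * x.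

Definition is_functorial_discretization (R : realType) (F : cstarFunctor R)
    (eta : forall A, starHom A (F A)) : Prop :=
  is_natural_unit eta /\
  exists iso : forall C, is_commutative C -> starHom (F C) (ell C),
    [/\ forall C cC, is_star_iso (iso C cC),
        forall C D cC cD (f : starHom C D),
          iso D cD \o fmap F f =1 ell_map f \o iso C cC
      & forall C cC, iso C cC \o eta C =1 gelfand C].

Lemma csub_image_sub (R : realType) (A B : cstarAlgType R) (f : starHom A B)
    (C : comSubalg A) (D : comSubalg B) :
  csub_set D = f @` csub_set C -> forall x, csub_set C x -> csub_set D (f x).
Proof. by move=> -> x Cx; exists x. Qed.

(* The functor F and the maps eta : A -> F(A) of the colimit formula, for some
   choice of the pushouts and colimits.  [colim_mapE] says that F(f) is induced
   by C |-> f(C), by f and by L(C) -> L(f(C)).  Since f(C) is always closed in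
   B, every C has exactly one D with underlying set f(C). *)
Record colimFunctor (R : realType) := ColimFunctor {
  colim_functor :> cstarFunctor R;
  colim_amalg : forall A, amalgams A;
  colim_leg : forall A (C : comSubalg A),
    starHom (colim_amalg A C) (colim_functor A);
  colimP : forall A, is_colimit (@colim_leg A);
  colim_mapE : forall A B (f : starHom A B) (C : comSubalg A)
      (D : comSubalg B) (fC : csub_set D = f @` csub_set C),
    exists g : starHom (colim_amalg A C) (colim_amalg B D),
      [/\ g \o amalg_l (colim_amalg A) C =1 amalg_l (colim_amalg B) D \o f,
          g \o amalg_r (colim_amalg A) C =1
            amalg_r (colim_amalg B) D \o ell_map (csub_map (csub_image_sub fC))
        & fmap colim_functor f \o colim_leg C =1 colim_leg D \o g];
  colim_eta : forall A, starHom A (colim_functor A);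
  colim_etaE : forall A (C : comSubalg A),
    colim_leg C \o amalg_l (colim_amalg A) C =1 colim_eta A
}.

(* The canonical maps L(C) -> A *_C L(C) -> F(A). *)
Definition colim_ell (R : realType) (F : colimFunctor R) (A : cstarAlgType R)
    (C : comSubalg A) : starHom (ell C) (F A) :=
  star_comp (colim_leg F C) (amalg_r (colim_amalg F A) C).

(* Main.v *)
From HB Require Import structures.
Require Import Defs.
From mathcomp Require Import all_boot all_order all_algebra.
From mathcomp Require Import complex ring lra.
From mathcomp Require Import boolp classical_sets functions reals.
From mathcomp Require Import topology normedtype sequences.


(* The colimit formula makes F(A) the universal recipient of a map eta from A
   together with a compatible family of maps L(C) -> F(A).  For commutative C
   the poset of subalgebras has C itself as top element, which gives
   F(C) = C *_C L(C) = L(C) and hence (a); (b) is the universal property; for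
   (c), the maps L(C) = F'(C) -> F'(A) form a compatible family.  Uniqueness in
   (c) holds because an element of F'(C) = L(C) is determined by its images
   under the characters C -> R[i], that is, by naturality, in
   F'(R[i]) = L(R[i]) = R[i].

   Three facts about C*-algebras enter.
   - *-homomorphisms f are contractive: for self-adjoint |h| < 1, the element
     f(h) is the real part of the unitary f(h + i sqrt(1 - h^2)).
   - *-homomorphisms have closed image, so that C |-> f(C) makes sense: elements
     of the image lift, up to a small error, to elements of comparable norm, by
     means of a |-> a (1 + i e a)^-1.
   - Colimits exist: every cocone induces a norm function on *-polynomial terms
     over the diagram; these functions form a set, and the colimit is the
     uniform closure of the terms in the product of one cocone for each. *)

Set Implicit Arguments.
Unset Strict Implicit.
Unset Printing Implicit Defensive.

Import Order.TTheory GRing.Theory Num.Theory.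
Import numFieldNormedType.Exports.

Local Open Scope classical_set_scope.
Local Open Scope ring_scope.
Local Open Scope complex_scope.

(** * Norms and completeness *)

Section RealNorm.
Context (R : realType) (V : normedModType R[i]).
Implicit Types x y z : V.

Lemma rnormr0 : rnormr (0 : V) = 0.
Proof. by rewrite /rnormr normr0. Qed.

Lemma rnormrD x y : rnormr (x + y) <= rnormr x + rnormr y.
Proof. by rewrite -lecR rmorphD /= !rnormrE ler_normD. Qed.

Lemma rnormrN x : rnormr (- x) = rnormr x.
Proof. by rewrite /rnormr normrN. Qed.

Lemma rnormrBC x y : rnormr (x - y) = rnormr (y - x).
Proof. by rewrite /rnormr distrC. Qed.

Lemma rnormrB x y : rnormr (x - y) <= rnormr x + rnormr y.
Proof. by rewrite -(rnormrN y) rnormrD. Qed.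

Lemma rnormrB_trans z x y : rnormr (x - y) <= rnormr (x - z) + rnormr (z - y).
Proof. by rewrite -(subrKA z) rnormrD. Qed.

Lemma rnormrZ (k : R[i]) x : rnormr (k *: x) = cabs k * rnormr x.
Proof. by apply: complexI; rewrite rmorphM /= !rnormrE cabsE normrZ. Qed.

Lemma rnormr_eq0 x : rnormr x = 0 -> x = 0.
Proof. by move=> x0; apply/normr0_eq0; rewrite -rnormrE x0. Qed.

Lemma rnormr_small x : (forall e : R, 0 < e -> rnormr x <= e) -> x = 0.
Proof.
move=> xe; apply/rnormr_eq0/eqP; rewrite eq_le rnormr_ge0 andbT.
by apply/ler_addgt0Pl => e e0; rewrite addr0 xe.
Qed.

Definition adherent (S : V -> Prop) x : Prop :=
  forall e : R, 0 < e -> exists2 y, S y & rnormr (x - y) <= e.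

Lemma adherent_closed (S : set V) : (forall x, adherent S x -> S x) -> closed S.
Proof.
move=> Scl x xS; apply: Scl => e e0.
have [y [Sy]] := xS _ (@nbhsx_ballx _ V x e%:C ltac:(by rewrite ltcR)).
by rewrite -ball_normE /= -rnormrE ltcR => /ltW xy; exists y.
Qed.

End RealNorm.

Lemma cabs_real (R : realType) (x : R) : 0 <= x -> cabs (x%:C) = x.
Proof. by move=> x0; apply: complexI; rewrite cabsE ger0_norm// lecR. Qed.

Lemma cabsi (R : realType) : cabs ('i : R[i]) = 1.
Proof. by rewrite /cabs normc_def /= expr0n /= expr1n add0r sqrtr1. Qed.

Lemma expr_small (R : realType) (q M e : R) :
  0 <= q < 1 -> 0 < e -> exists n, M * q ^+ n <= e.
Proof.
move=> /andP[q0 q1] e0.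
have /cvgrPdist_lt /(_ e e0)[N _ /(_ N (leqnn _))] :
    (fun n => M * q ^+ n) @ \oo --> (M * 0 : R).
  by apply: cvgMl_tmp; apply: cvg_expr; rewrite ger0_norm.
rewrite /= mulr0 sub0r normrN => qN; exists N.
by apply/ltW/(le_lt_trans _ qN)/ler_norm.
Qed.

Section Completeness.
Context (R : realType) (V : completeNormedModType R[i]).

Lemma geometric_cvg (u : nat -> V) (M q : R) : 0 <= q < 1 ->
  (forall n, rnormr (u n.+1 - u n) <= M * q ^+ n) ->
  exists l, forall n, rnormr (u n - l) <= M / (1 - q) * q ^+ n.
Proof.
move=> q01 uM; have /andP[q0 q1] := q01.
have q1' : 0 < 1 - q by rewrite subr_gt0.
have M0 : 0 <= M.
  by have := uM 0%N; rewrite expr0 mulr1; apply: le_trans; apply: rnormr_ge0.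
(* The factor [1 - q ^+ k] is that of the partial geometric sum; with it the induction step closes
   as an identity. *)
have uB k n : rnormr (u (n + k)%N - u n) <= M / (1 - q) * (1 - q ^+ k) * q ^+ n.
  elim: k => [|k IHk]; first by rewrite addn0 !subrr mulr0 mul0r rnormr0.
  apply: le_trans (rnormrB_trans (u (n + k)%N) _ _) _.
  rewrite addnS; apply: le_trans (lerD (uM _) IHk) _.
  rewrite le_eqVlt; apply/orP; left; apply/eqP.
  by rewrite exprD exprS; field; rewrite gt_eqF.
have uB' k n : rnormr (u (n + k)%N - u n) <= M / (1 - q) * q ^+ n.
  apply: le_trans (uB k n) _; rewrite ler_wpM2r ?exprn_ge0//.
  by rewrite ler_piMr ?divr_ge0 ?(ltW q1')// gerBl exprn_ge0.
have uB2 m n N : (N <= m)%N -> (N <= n)%N ->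
    rnormr (u m - u n) <= M / (1 - q) * q ^+ N + M / (1 - q) * q ^+ N.
  move=> /subnKC <- /subnKC <-; apply: le_trans (rnormrB_trans (u N) _ _) _.
  by rewrite [X in _ + X]rnormrBC lerD.
have [e e0|l _ lP] := @complete_seq_cvg R V u.
  have e4 : 0 < e / 4 by rewrite divr_gt0.
  have [N NP] := expr_small (M / (1 - q)) q01 e4.
  exists N => m n Nm Nn; rewrite -rnormrE ltcR.
  by apply: le_lt_trans (uB2 _ _ _ Nm Nn) _; lra.
exists l => n; apply/ler_addgt0Pr => e e0; have [N NP] := lP e e0.
apply: le_trans (rnormrB_trans (u (n + N)%N) _ _) _.
rewrite lerD//; first by rewrite rnormrBC uB'.
by apply/ltW; rewrite -ltcR rnormrE NP// leq_addl.
Qed.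

(** Banach's fixed point theorem on a closed set [S], which carries side conditions such as
    self-adjointness or a norm bound through to the limit. *)
Lemma contraction_fixpoint (S : V -> Prop) (g : V -> V) (q : R) (x0 : V) :
  0 <= q < 1 -> S x0 -> (forall x, S x -> S (g x)) ->
  (forall x y, S x -> S y -> rnormr (g x - g y) <= q * rnormr (x - y)) ->
  (forall x, adherent S x -> S x) ->
  exists2 x, S x & g x = x.
Proof.
move=> q01 S0 gS gq Scl; have /andP[q0 q1] := q01.
pose u n := iter n g x0; pose M := rnormr (u 1 - u 0).
have uS n : S (u n) by elim: n => //= n; exact: gS.
have uM n : rnormr (u n.+1 - u n) <= M * q ^+ n.
  elim: n => [|n IHn]; first by rewrite expr0 mulr1.
  apply: le_trans (gq _ _ (uS n.+1) (uS n)) _.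
  by rewrite exprS mulrCA ler_wpM2l.
have [l lP] := geometric_cvg q01 uM.
have Sl : S l.
  apply: Scl => e e0; have [n nP] := expr_small (M / (1 - q)) q01 e0.
  by exists (u n) => //; rewrite rnormrBC; apply: le_trans (lP n) nP.
exists l => //; apply/subr0_eq/rnormr_small => e e0.
have [n nP] := expr_small (M / (1 - q)) q01 (divr_gt0 e0 (ltr0Sn R 1)).
apply: le_trans (rnormrB_trans (u n.+1) _ _) _; rewrite (splitr e) lerD//.
  rewrite rnormrBC; apply: le_trans (gq _ _ (uS n) Sl) _.
  apply: le_trans nP; apply: le_trans (lP n).
  by rewrite ler_piMl ?rnormr_ge0// ltW.
apply: le_trans (lP n.+1) _; apply: le_trans nP.
have q1' : 0 < 1 - q by rewrite subr_gt0.
rewrite ler_wpM2l ?divr_ge0 ?rnormr_ge0 ?(ltW q1')//.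
by rewrite exprS ler_piMl ?exprn_ge0// ltW.
Qed.

End Completeness.

(** * Contractivity and resolvents *)

(* [star], retyped as a map of the ring [A] rather than of the normed module
   underlying it, so that ring operations on its values are inferred. *)
Definition adj (R : realType) (A : cstarAlgType R) : A -> A := @star R A.

Section CstarNorm.
Context (R : realType) (A : cstarAlgType R).
Implicit Types (x y : A) (k : R[i]).

Lemma calg_scaleAl k x y : k *: (x * y) = k *: x * y.
Proof. exact: cstar_scaleAl. Qed.

Lemma calg_scaleAr k x y : k *: (x * y) = x * (k *: y).
Proof. exact: cstar_scaleAr. Qed.

Lemma adjK : involutive (@adj R A).
Proof. exact: starK. Qed.

Lemma adjD x y : adj (x + y) = adj x + adj y.
Proof. exact: starD. Qed.

Lemma adjZ k x : adj (k *: x) = conjc k *: adj x.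
Proof. exact: starZ. Qed.

Lemma adjM x y : adj (x * y) = adj y * adj x.
Proof. exact: starM. Qed.

Lemma adj0 : adj (0 : A) = 0.
Proof. by rewrite -(scale0r (0 : A)) adjZ rmorph0 !scale0r. Qed.

Lemma adjN x : adj (- x) = - adj x.
Proof. by apply/eqP; rewrite -addr_eq0 -adjD addNr adj0. Qed.

Lemma adjB x y : adj (x - y) = adj x - adj y.
Proof. by rewrite adjD adjN. Qed.

Lemma adj1 : adj (1 : A) = 1.
Proof. by rewrite -[LHS]mulr1 -[X in _ * X]adjK -adjM mulr1 adjK. Qed.

Lemma rnormrM x y : rnormr (x * y) <= rnormr x * rnormr y.
Proof. by rewrite -lecR rmorphM /= !rnormrE cstar_normM. Qed.

Lemma rnormr_adjM x : rnormr (adj x * x) = rnormr x ^+ 2.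
Proof. by apply: complexI; rewrite rmorphXn /= !rnormrE cstar_norm. Qed.

(** The C*-identity gives [|y|^2 <= |adj y| |y|], where [|y|] cancels; the reverse inequality is the
    same one for the adjoint. *)
Lemma rnormr_adj x : rnormr (adj x) = rnormr x.
Proof.
suff le_adj y : rnormr y <= rnormr (adj y).
  by apply/eqP; rewrite eq_le le_adj -{2}(adjK x) le_adj.
have := rnormr_ge0 y; rewrite le_eqVlt => /orP[/eqP <-|y0].
  exact: rnormr_ge0.
by rewrite -(ler_pM2r y0) -expr2 -rnormr_adjM rnormrM.
Qed.

(** From [|1|^2 = |1|]. Equality fails in the zero algebra, where [|1| = 0]. *)
Lemma rnormr1_le1 : rnormr (1 : A) <= 1.
Proof.
have := rnormr_adjM 1; rewrite adj1 mulr1.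
by have := rnormr_ge0 (1 : A); nra.
Qed.

Lemma unitary_le1 x : adj x * x = 1 -> rnormr x <= 1.
Proof.
move=> xx; rewrite -(ler_pXn2r (n := 2))// ?nnegrE ?rnormr_ge0//.
by rewrite -rnormr_adjM xx expr1n rnormr1_le1.
Qed.

Lemma conjci : conjc 'i = - 'i :> R[i].
Proof. by apply/eqP; rewrite eq_complex /= oppr0 !eqxx. Qed.

Lemma mulii : 'i * 'i = -1 :> R[i].
Proof. exact: sqr_i. Qed.

Lemma half_half : 2^-1 + 2^-1 = 1 :> R[i].
Proof. by rewrite [RHS]splitr mul1r. Qed.

Lemma self_adjoint_decomposition x : exists a b : A,
  [/\ adj a = a, adj b = b & x = a + 'i *: b].
Proof.
pose h : R[i] := 2^-1.
have hJ : conjc h = h by rewrite /h conjc_inv conjc_nat.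
exists (h *: (x + adj x)), (h *: ('i *: (adj x - x))); split.
- by rewrite adjZ adjD adjK hJ [_ + x]addrC.
- by rewrite adjZ hJ adjZ adjB adjK conjci scaleNr -scalerN opprB.
- rewrite [X in _ + X]scalerA mulrC -scalerA (scalerA 'i 'i) mulii.
  rewrite scaleN1r opprB -scalerDr addrACA subrr addr0.
  by rewrite scalerDr -scalerDl half_half scale1r.
Qed.

End CstarNorm.

Section StarHomTheory.
Context (R : realType) (A B : cstarAlgType R) (f : starHom A B).

Lemma starHom0 : f 0 = 0.
Proof. exact: raddf0. Qed.

Lemma starHom1 : f 1 = 1.
Proof. exact: rmorph1. Qed.

Lemma starHomD x y : f (x + y) = f x + f y.
Proof. exact: raddfD. Qed.

Lemma starHomB x y : f (x - y) = f x - f y.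
Proof. exact: raddfB. Qed.

Lemma starHomM x y : f (x * y) = f x * f y.
Proof. exact: rmorphM. Qed.

Lemma starHomZ k x : f (k *: x) = k *: f x.
Proof. by have := starHom_linear f k x 0; rewrite addr0 raddf0 addr0. Qed.

Lemma starHom_adj x : f (adj x) = adj (f x).
Proof. exact: starHom_star. Qed.

End StarHomTheory.

(** The hypothesis is the fixed point equation solved below: its solution [y] makes [1 - y] a square
    root of [1 - h^2]. *)
Lemma sqr_addB_eq1 (S : pzRingType) (h y : S) :
  y + y = h * h + y * y -> h * h + (1 - y) * (1 - y) = 1.
Proof.
move=> yy; rewrite mulrBl mul1r mulrBr mulr1 -addrA -opprD (addrA y) yy addrK.
by rewrite [LHS]addrC subrK.
Qed.

(** * Square roots of [1 - h^2], and contractivity of homomorphisms *)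

Section Roots.
Context (R : realType) (A : cstarAlgType R).
Implicit Types (x y : A).

(** Writing the root as [1 - y] turns the equation into [y = (h^2 + y^2) / 2]. The right side maps
    the ball of radius [r = |h|^2 < 1] into itself and contracts by the factor [r] there;
    self-adjointness and commutation with [h] survive the iteration. *)
Lemma self_adjoint_sqrt h : adj h = h -> rnormr h < 1 ->
  exists k : A, [/\ adj k = k, k * h = h * k & h * h + k * k = 1].
Proof.
move=> hJ h1; pose w := h * h; pose r := rnormr h ^+ 2.
have h0 := rnormr_ge0 h.
have r01 : 0 <= r < 1 by rewrite exprn_ge0//= expr_lt1.
have /andP[r0 r1] := r01.
have wr : rnormr w <= r by rewrite /r -rnormr_adjM hJ.
pose half : R[i] := 2^-1.
have halfE : cabs half = 2^-1.
  have -> : half = (2^-1)%:C by rewrite fmorphV rmorph_nat.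
  by rewrite cabs_real ?invr_ge0.
have [y [yJ yh _] yE] : exists2 y : A,
    [/\ adj y = y, y * h = h * y & rnormr y <= r] & half *: (w + y * y) = y.
  apply: (@contraction_fixpoint R A
    (fun y : A => [/\ adj y = y, y * h = h * y & rnormr y <= r])
    (fun y : A => half *: (w + y * y)) r 0 r01).
  - by rewrite adj0 mul0r mulr0 rnormr0.
  - move=> y [yJ yh yr]; split.
    + by rewrite adjZ adjD !adjM yJ hJ /half conjc_inv conjc_nat.
    + rewrite -calg_scaleAl -calg_scaleAr; congr (_ *: _).
      by rewrite mulrDl mulrDr /w mulrA -(mulrA y y) yh mulrA yh mulrA.
    + rewrite rnormrZ halfE ler_pdivrMl//.
      apply: le_trans (rnormrD _ _) _.
      apply: le_trans (lerD wr (rnormrM _ _)) _.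
      by have := rnormr_ge0 y; nra.
  - move=> x y [_ _ xr] [_ _ yr].
    (* [x] and [y] may fail to commute, so [x^2 - y^2] is split as [x (x - y) + (x - y) y]; each
       summand has norm at most [r |x - y|]. *)
    have -> : half *: (w + x * x) - half *: (w + y * y) =
        half *: (x * (x - y) + (x - y) * y).
      rewrite -scalerBr mulrBr mulrBl addrA subrK; congr (_ *: _).
      by rewrite opprD addrACA subrr add0r.
    rewrite rnormrZ halfE ler_pdivrMl//; apply: le_trans (rnormrD _ _) _.
    apply: le_trans (lerD (rnormrM _ _) (rnormrM _ _)) _.
    by have := rnormr_ge0 (x - y); nra.
  - move=> y yS; split.
    + apply/subr0_eq/rnormr_small => e e0.
      have [z [zJ _ _] yz] := yS _ (divr_gt0 e0 (ltr0Sn R 1)).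
      apply: le_trans (rnormrB_trans z _ _) _; rewrite (splitr e) lerD//.
        by rewrite -{1}zJ -adjB rnormr_adj.
      by rewrite rnormrBC.
    + apply/subr0_eq/rnormr_small => e e0.
      have [z [_ zh _] yz] := yS _ (divr_gt0 e0 (ltr0Sn R 1)).
      apply: le_trans (rnormrB_trans (z * h) _ _) _; rewrite (splitr e) lerD//.
        rewrite -mulrBl; apply: le_trans (rnormrM _ _) _.
        by apply: le_trans yz; rewrite ler_piMr ?rnormr_ge0// ltW.
      rewrite zh -mulrBr; apply: le_trans (rnormrM _ _) _.
      rewrite rnormrBC; apply: le_trans yz.
      by rewrite ler_piMl ?rnormr_ge0// ltW.
    + apply/ler_addgt0Pr => e e0; have [z [_ _ zr] yz] := yS e e0.
      by have := rnormrD (y - z) z; rewrite subrK; lra.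
exists (1 - y); split.
- by rewrite adjB adj1 yJ.
- by rewrite mulrBl mulrBr mul1r mulr1 yh.
- have yy : y + y = h * h + y * y.
    by rewrite -{1 2}yE -scalerDl half_half scale1r.
  exact: sqr_addB_eq1.
Qed.

End Roots.

Section Contractive.
Context (R : realType) (A B : cstarAlgType R) (f : starHom A B).

(* With [k = sqrt (1 - h^2)], the element [f h + i f k] is unitary and [f h] is
   its real part. *)
Lemma starHom_self_adjoint_le1 (h : A) :
  adj h = h -> rnormr h < 1 -> rnormr (f h) <= 1.
Proof.
move=> hJ h1; have [k [kJ kh hk1]] := self_adjoint_sqrt hJ h1.
pose u := f h + 'i *: f k.
have uJ : adj u = f h - 'i *: f k.
  by rewrite adjD adjZ -!starHom_adj hJ kJ conjci scaleNr.
have u1 : rnormr u <= 1.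
  apply: unitary_le1; rewrite uJ mulrDr !mulrBl -!calg_scaleAl -!calg_scaleAr.
  rewrite scalerA mulii scaleN1r opprK -!rmorphM kh.
  by rewrite addrA subrK -rmorphD hk1 rmorph1.
have -> : f h = 2^-1 *: (u + adj u).
  by rewrite uJ addrACA subrr addr0 scalerDr -scalerDl half_half scale1r.
rewrite rnormrZ; have -> : 2^-1 = (2^-1 : R)%:C by rewrite fmorphV rmorph_nat.
rewrite cabs_real ?invr_ge0// ler_pdivrMl// mulr1.
by apply: le_trans (rnormrD _ _) _; rewrite rnormr_adj; lra.
Qed.

(** By the C*-identity it suffices to treat the self-adjoint [adj x * x]. If [|f h|] exceeded [|h|],
    dividing [h] by a number [s] strictly between them would contradict the bound for norms below
    1. *)
Lemma starHom_le (x : A) : rnormr (f x) <= rnormr x.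
Proof.
suff le_sa (h : A) : adj h = h -> rnormr (f h) <= rnormr h.
  rewrite -(ler_pXn2r (n := 2))// ?nnegrE ?rnormr_ge0//.
  by rewrite -!rnormr_adjM -starHom_adj -rmorphM le_sa// adjM adjK.
move=> hJ; rewrite leNgt; apply/negP => /midf_lt[].
set s := (_ / 2) => hs sf.
have s0 : 0 < s by apply: le_lt_trans hs; apply: rnormr_ge0.
have s'E : cabs (s^-1)%:C = s^-1 by rewrite cabs_real// invr_ge0 ltW.
have := @starHom_self_adjoint_le1 ((s^-1)%:C *: h).
rewrite adjZ hJ conjc_real starHomZ !rnormrZ s'E => /(_ erefl).
by rewrite !(ler_pdivrMl, ltr_pdivrMl)// mulr1 leNgt sf => /(_ hs).
Qed.

End Contractive.

(** * Resolvents of self-adjoint elements *)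

Lemma mulr_addB_comm (S : pzRingType) (x y : S) :
  x * y = y * x -> (x + y) * (x - y) = x * x - y * y.
Proof. by move=> xy; rewrite mulrDl !mulrBr xy addrA subrK. Qed.

(** Serves the unitarity of the Cayley transform: normality exchanges the two middle factors, after
    which each cancels against its outer neighbour. *)
Lemma mulr_comm_inv_eq1 (S : pzRingType) (x y v w : S) :
  x * y = y * x -> w * x = 1 -> y * v = 1 -> w * (y * x) * v = 1.
Proof. by move=> xy wx yv; rewrite -xy mulrA wx mul1r. Qed.

Section Resolvent.
Context (R : realType) (A : cstarAlgType R).
Implicit Types (a x y z : A) (k : R[i]).

Lemma scalar_comm k x : x * (k *: (1 : A)) = k *: (1 : A) * x.
Proof. by rewrite -calg_scaleAl -calg_scaleAr mul1r mulr1. Qed.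

Lemma scalarM k l : k *: (1 : A) * (l *: (1 : A)) = (k * l) *: (1 : A).
Proof. by rewrite -calg_scaleAl mul1r scalerA. Qed.

Lemma neumann_inverse x : rnormr x < 1 -> exists y, (1 - x) * y = 1.
Proof.
move=> x1; have [|y yE] := @cstar_fixpoint R A x.
  by rewrite -rnormrE -[1]/((1 : R)%:C) ltcR.
by exists y; rewrite mulrBl mul1r {1}yE addrK.
Qed.

(* [a + i = (1 + t) i (1 - x)] with [x] small when [t] is large, since
   [|a - i t|^2 <= |a|^2 + t^2]. *)
Lemma self_adjoint_right_inverse a : adj a = a ->
  exists z, (a + 'i *: (1 : A)) * z = 1.
Proof.
(* With this [t], the element [d = a - i t] satisfies [|d|^2 <= t + t^2 < (1 + t)^2], so
   [d / (1 + t)] has norm below 1. *)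
move=> aJ; pose t := rnormr a ^+ 2.
have t0 : 0 <= t by rewrite exprn_ge0// rnormr_ge0.
pose it : R[i] := 'i * t%:C.
have itJ : conjc it = - it.
  rewrite [LHS]rmorphM -[RHS]mulNr -conjci; congr (_ * _).
  exact: conjc_real.
have itM : it * it = - (t * t)%:C.
  by rewrite mulrACA mulii mulN1r -rmorphM.
pose d := a - it *: (1 : A).
have dJ : adj d = a + it *: (1 : A).
  by rewrite adjB adjZ adj1 aJ itJ scaleNr opprK.
have dle : rnormr d < 1 + t.
  rewrite -(ltr_pXn2r (n := 2))// ?nnegrE ?rnormr_ge0 ?addr_ge0//.
  rewrite -rnormr_adjM dJ mulr_addB_comm ?scalar_comm//.
  rewrite scalarM itM scaleNr opprK.
  apply: le_lt_trans (rnormrD _ _) _.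
  apply: (@le_lt_trans _ _ (t + t * t)); last by nra.
  apply: lerD; first exact: rnormrM.
  have tt0 : 0 <= t * t by apply: mulr_ge0.
  by rewrite rnormrZ cabs_real//; apply: ler_piMr => //; apply: rnormr1_le1.
have t1 : 1 + t != 0 by rewrite gt_eqF// ltr_wpDr.
pose k : R[i] := ((1 + t)^-1)%:C.
have k1 : k * (1 + t)%:C = 1 by rewrite /k -rmorphM mulVf.
have [|y yE] := @neumann_inverse (('i * k) *: d).
  rewrite rnormrZ cabsM cabsi mul1r cabs_real ?invr_ge0 ?addr_ge0//.
  by rewrite ltr_pdivrMl ?mulr1// ltr_wpDr.
pose c : R[i] := 'i * (1 + t)%:C.
have c0 : c != 0.
  rewrite mulf_neq0//; last by rewrite -[0]/((0 : R)%:C) (inj_eq (@complexI R)).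
  by rewrite eq_complex /= oner_eq0 andbF.
exists (c^-1 *: y).
have -> : a + 'i *: (1 : A) = c *: (1 - ('i * k) *: d).
  have cik : c * ('i * k) = -1 by rewrite mulrACA mulii [_ * k]mulrC k1 mulr1.
  rewrite scalerBr scalerA cik scaleN1r opprK /d addrCA.
  rewrite -scaleNr -scalerDl; congr (a + _ *: _).
  by rewrite /c /it rmorphD rmorph1 mulrDr mulr1 addrK.
by rewrite -calg_scaleAl -calg_scaleAr scalerA mulfV// scale1r.
Qed.

(* The Cayley transform [u = (a + i) (a - i)^-1] is unitary, and
   [(a - i)^-1 = (u - 1) / 2 i]. *)
Lemma self_adjoint_resolvent a : adj a = a -> exists v,
  [/\ (a - 'i *: (1 : A)) * v = 1, v * (a - 'i *: (1 : A)) = 1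
    & rnormr v <= 1].
Proof.
move=> aJ; have [z zE] := self_adjoint_right_inverse aJ.
(* A right inverse of [- a + i] is, up to sign, one of [b = a - i]; [adj z] is a left inverse of
   [b], so the two coincide. *)
have /self_adjoint_right_inverse[z' z'E] : adj (- a) = - a by rewrite adjN aJ.
pose b := a - 'i *: (1 : A).
have bJ : adj b = a + 'i *: (1 : A).
  by rewrite adjB adjZ adj1 aJ conjci scaleNr opprK.
have vb : adj z * b = 1.
  by have := congr1 (@adj R A) zE; rewrite adjM -bJ adjK adj1.
have bw : b * - z' = 1 by rewrite mulrN -mulNr opprB addrC.
have vw : adj z = - z' by rewrite -[LHS]mulr1 -bw mulrA vb mul1r.
have bv : b * adj z = 1 by rewrite vw.
exists (adj z); split=> //.
have bJb : adj b * b = b * adj b.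
  rewrite bJ /b mulr_addB_comm ?scalar_comm//.
  by rewrite mulrBl !mulrDr scalar_comm opprD addrA addrK.
have u1 : rnormr (adj b * adj z) <= 1.
  apply: unitary_le1; rewrite adjM !adjK mulrA -(mulrA z).
  apply: mulr_comm_inv_eq1 => //.
  by have := congr1 (@adj R A) bv; rewrite adjM adjK adj1.
have uE : adj b * adj z = 1 + ('i + 'i) *: adj z.
  have -> : adj b = b + ('i + 'i) *: (1 : A).
    by rewrite bJ /b scalerDl addrA subrK.
  by rewrite mulrDl bv -calg_scaleAl mul1r.
have : rnormr (('i + 'i) *: adj z) <= 2.
  have -> : ('i + 'i) *: adj z = adj b * adj z - 1.
    by rewrite uE addrAC subrr add0r.
  by apply: le_trans (rnormrB _ _) _; have := rnormr1_le1 A; lra.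
have -> : 'i + 'i = 2%:C * 'i :> R[i] by rewrite rmorph_nat mulr_natl.
by rewrite rnormrZ cabsM cabsi cabs_real// mulr1; lra.
Qed.

End Resolvent.

(** * Closed images *)

Section ImageClosed.
Context (R : realType) (A B : cstarAlgType R) (f : starHom A B).

(* For small [e], the element [a (1 + i e a)^-1] is close to [a] as seen by [f],
   where [a] is small, while its norm is at most [2 / e] no matter how large [a]
   is. *)
Lemma approx_lift_self_adjoint (a : A) (r : R) : adj a = a -> 0 < r ->
  rnormr (f a) <= r ->
  exists x, rnormr x <= 8 * r /\ rnormr (f a - f x) <= r / 4.
Proof.
(* With this [e], the bound [2 / e] is [8 r], and the error [|f a| |f v| |e f a|] is at most
   [e r^2 = r / 4]. *)
move=> aJ r0 far; pose e := (4 * r)^-1; pose a1 := e%:C *: a.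
have e0 : 0 < e by rewrite invr_gt0 mulr_gt0.
have re : 4 * r * e = 1 by rewrite mulfV// gt_eqF// mulr_gt0.
have [|v [bv vb v1]] := @self_adjoint_resolvent R A a1.
  by rewrite adjZ aJ conjc_real.
(* Since [1 + i a1 = i (a1 - i)], this is [a (1 + i a1)^-1]. *)
exists ((- 'i) *: (a * v)).
have av : a1 * v = 1 + 'i *: v.
  have -> : a1 = a1 - 'i *: (1 : A) + 'i *: (1 : A) by rewrite subrK.
  by rewrite mulrDl bv -calg_scaleAl mul1r.
have aav : a - (- 'i) *: (a * v) = a * v * a1.
  have va : v * a1 = 1 + 'i *: v.
    have -> : a1 = a1 - 'i *: (1 : A) + 'i *: (1 : A) by rewrite subrK.
    by rewrite mulrDr vb -calg_scaleAr mulr1.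
  by rewrite -mulrA va mulrDr mulr1 -calg_scaleAr scaleNr opprK.
split.
  have : rnormr (a1 * v) <= 2.
    rewrite av; apply: le_trans (rnormrD _ _) _.
    by rewrite rnormrZ cabsi; have := rnormr1_le1 A; lra.
  rewrite -calg_scaleAl !rnormrZ cabs_real ?(ltW e0)//.
  have -> : cabs (- 'i) = 1 :> R by rewrite /cabs normrN; exact: cabsi.
  have := rnormr_ge0 (a * v); nra.
have -> : f a - f ((- 'i) *: (a * v)) = f a * f v * (e%:C *: f a).
  by rewrite -starHomZ -!starHomM -aav starHomB.
apply: le_trans (rnormrM _ _) _; rewrite rnormrZ cabs_real ?(ltW e0)//.
apply: le_trans (ler_wpM2r _ (rnormrM _ _)) _.
  by rewrite mulr_ge0 ?rnormr_ge0 ?(ltW e0).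
have := le_trans (starHom_le f v) v1.
have := rnormr_ge0 (f a); have := rnormr_ge0 (f v).
move: (rnormr _) (rnormr _) far => p q qr p0 q0 p1.
have : q * p * (e * q) <= r * 1 * (e * r).
  apply: ler_pM; rewrite ?mulr_ge0 ?(ltW e0)//; first exact: ler_pM.
  by rewrite ler_wpM2l ?(ltW e0).
nra.
Qed.

(** Real and imaginary parts are lifted separately: [f] preserves adjoints, so both parts of [f x]
    have norm at most [r], and the two errors [r / 4] add up. *)
Lemma approx_lift (x : A) (r : R) : 0 < r -> rnormr (f x) <= r ->
  exists y, rnormr y <= 16 * r /\ rnormr (f x - f y) <= r / 2.
Proof.
move=> r0 fxr; have [a [b [aJ bJ xE]]] := self_adjoint_decomposition x.
have fJ : f (adj x) = f a - 'i *: f b.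
  by rewrite xE adjD adjZ aJ bJ conjci starHomD starHomZ scaleNr.
have fE : f x = f a + 'i *: f b by rewrite xE starHomD starHomZ.
have fxJr : rnormr (f (adj x)) <= r by rewrite starHom_adj rnormr_adj.
have half_le (y z : B) : y + y = z -> rnormr z <= r + r -> rnormr y <= r.
  move=> <-; rewrite -mulr2n -scaler_nat rnormrZ.
  have -> : 2%:R = 2%:C :> R[i] by rewrite rmorph_nat.
  by rewrite cabs_real//; lra.
have far : rnormr (f a) <= r.
  apply: (half_le _ (f x + f (adj x))).
    by rewrite fE fJ addrACA subrr addr0.
  by apply: le_trans (rnormrD _ _) _; rewrite lerD.
have fbr : rnormr (f b) <= r.
  have -> : rnormr (f b) = rnormr ('i *: f b) by rewrite rnormrZ cabsi mul1r.
  apply: (half_le _ (f x - f (adj x))).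
    by rewrite fE fJ opprB [RHS]addrC addrA subrK.
  by apply: le_trans (rnormrB _ _) _; rewrite lerD.
have [a' [a'r aa']] := approx_lift_self_adjoint aJ r0 far.
have [b' [b'r bb']] := approx_lift_self_adjoint bJ r0 fbr.
exists (a' + 'i *: b'); split.
  apply: le_trans (rnormrD _ _) _; rewrite rnormrZ cabsi mul1r; lra.
rewrite fE starHomD starHomZ opprD addrACA -scalerBr.
by apply: le_trans (rnormrD _ _) _; rewrite rnormrZ cabsi mul1r; lra.
Qed.

(** Successive approximation as in the open mapping theorem: each correction reduces the remaining
    error by the factor [q] and has norm proportional to that error, so the approximate preimages
    converge. *)
Lemma starHom_image_closed : closed (range f).
Proof.
apply: adherent_closed => y yf; pose q : R := 3 / 4.
have q01 : 0 <= q < 1 by rewrite /q; lra.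
have step z (s : R) : 0 < s -> adherent (range f) z -> rnormr z <= s ->
    exists x, rnormr x <= 18 * s /\ rnormr (z - f x) <= s * q.
  move=> s0 zf zs.
  (* A value of [f] within [s / 8] of [z] has norm at most [9 s / 8]; lifting it costs norm [18 s]
     and error [9 s / 16], in total [11 s / 16 <= q s]. *)
  have [_ [x _ <-] zx] := zf (s / 8) ltac:(by rewrite divr_gt0).
  have [||x' [x'r xx']] := @approx_lift x (9 / 8 * s); first lra.
    by have := rnormrD (f x - z) z; rewrite subrK rnormrBC; lra.
  exists x'; split; first by apply: le_trans x'r _; lra.
  by apply: le_trans (rnormrB_trans (f x) _ _) _; rewrite /q; lra.
pose r := rnormr y + 1; have r0 : 0 < r by rewrite ltr_wpDl ?rnormr_ge0.
have rq n : 0 < r * q ^+ n by rewrite mulr_gt0// exprn_gt0// /q; lra.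
(* The next approximation is a function of the pair of index and current point, with default 0 where
   the error bound fails; dependent choice thus becomes plain recursion. *)
have [next nextP] : {next : nat * A -> A & forall p,
    rnormr (y - f p.2) <= r * q ^+ p.1 ->
    rnormr (next p - p.2) <= 18 * r * q ^+ p.1 /\
    rnormr (y - f (next p)) <= r * q ^+ p.1.+1}.
  apply: (boolp.choice (P := fun (p : nat * A) x =>
    rnormr (y - f p.2) <= r * q ^+ p.1 ->
    rnormr (x - p.2) <= 18 * r * q ^+ p.1 /\
    rnormr (y - f x) <= r * q ^+ p.1.+1)) => -[n x] /=.
  have [yx|] := pselect (rnormr (y - f x) <= r * q ^+ n); last by exists 0.
  have [|x' [x'r yx']] := step (y - f x) _ (rq n) _ yx.
    move=> e e0; have [_ [z _ <-] yz] := yf e e0.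
    by exists (f (z - x)); [exists (z - x)|rewrite starHomB opprB addrA subrK].
  exists (x' + x) => _; rewrite addrK starHomD exprSr mulrA -mulrA.
  by rewrite [f x' + _]addrC opprD addrA mulrA -(mulrA 18).
pose u := fix u n := if n is m.+1 then next (m, u m) else 0 : A.
have yu n : rnormr (y - f (u n)) <= r * q ^+ n.
  elim: n => [|n IHn]; last by have [] := nextP (n, u n) IHn.
  by rewrite /= starHom0 subr0 expr0 mulr1 /r; lra.
have [l lP] := @geometric_cvg R A u (18 * r) q q01
  (fun n => (nextP (n, u n) (yu n)).1).
exists l => //; apply/esym/subr0_eq/rnormr_small => e e0.
have [n nP] := expr_small (r + 18 * r / (1 - q)) q01 e0.
apply: le_trans (rnormrB_trans (f (u n)) _ _) _; apply: le_trans nP.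
rewrite mulrDl lerD// -starHomB; apply: le_trans (starHom_le _ _) _; exact: lP.
Qed.

End ImageClosed.

(** * Colimits *)

Section UniformClosure.
Context (R : realType) (I : Type) (D : I -> cstarAlgType R).

(** Formal noncommutative polynomials with adjoints, subject to no identities: relations hold only
    after evaluation. *)
Inductive star_term : Type :=
| TGen (i : I) (x : D i)
| TOne
| TAdd (s t : star_term)
| TScale (k : R[i]) (t : star_term)
| TMul (s t : star_term)
| TAdj (t : star_term).

Section Evaluation.
Context (M : cstarAlgType R) (leg : forall i, starHom (D i) M).

Fixpoint term_eval (t : star_term) : M :=
  match t with
  | TGen i x => leg i x
  | TOne => 1
  | TAdd s t => term_eval s + term_eval t
  | TScale k t => k *: term_eval t
  | TMul s t => term_eval s * term_eval t
  | TAdj t => adj (term_eval t)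
  end.

End Evaluation.

Fixpoint term_bound (t : star_term) : R :=
  match t with
  | TGen i x => rnormr x
  | TOne => 1
  | TAdd s t => term_bound s + term_bound t
  | TScale k t => cabs k * term_bound t
  | TMul s t => term_bound s * term_bound t
  | TAdj t => term_bound t
  end.

(** Contractivity makes the bound depend on the term alone and not on the algebra, so the
    evaluations of a term form a bounded family. *)
Lemma term_eval_le (M : cstarAlgType R) (leg : forall i, starHom (D i) M) t :
  rnormr (term_eval leg t) <= term_bound t.
Proof.
elim: t => /= [i x||s IHs t IHt|k t IHt|s IHs t IHt|t IHt].
- exact: starHom_le.
- exact: rnormr1_le1.
- by apply: le_trans (rnormrD _ _) _; apply: lerD.
- by rewrite rnormrZ ler_wpM2l ?cabs_ge0.
- by apply: le_trans (rnormrM _ _) _; rewrite ler_pM ?rnormr_ge0.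
- by rewrite rnormr_adj.
Qed.

Lemma term_eval_comp (M N : cstarAlgType R) (h : starHom M N)
    (leg : forall i, starHom (D i) M) (leg' : forall i, starHom (D i) N) :
  (forall i, h \o leg i =1 leg' i) ->
  forall t, h (term_eval leg t) = term_eval leg' t.
Proof.
move=> hleg; elim=> /= [i x||s IHs t IHt|k t IHt|s IHs t IHt|t IHt].
- exact: hleg.
- exact: starHom1.
- by rewrite starHomD IHs IHt.
- by rewrite starHomZ IHt.
- by rewrite starHomM IHs IHt.
- by rewrite starHom_adj IHt.
Qed.

Context (K : Type) (M : K -> cstarAlgType R).
Context (leg : forall k i, starHom (D i) (M k)).
Implicit Types x y z : forall k, M k.

(** One term must serve all [k] at once: the closure is taken in the supremum norm. *)
Definition term_approx x : Prop := forall e : R, 0 < e ->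
  exists t, forall k, rnormr (x k - term_eval (leg k) t) <= e.

Lemma term_approx_ext x y :
  (forall k, x k = y k) -> term_approx x -> term_approx y.
Proof.
by move=> xy xA e e0; have [t tP] := xA e e0; exists t => k; rewrite -xy.
Qed.

Lemma term_approx_eval t : term_approx (fun k => term_eval (leg k) t).
Proof. by move=> e e0; exists t => k; rewrite subrr rnormr0 ltW. Qed.

Lemma term_approx_lim x :
  (forall e : R, 0 < e ->
     exists2 y, term_approx y & forall k, rnormr (x k - y k) <= e) ->
  term_approx x.
Proof.
move=> xlim e e0; have e2 : 0 < e / 2 by rewrite divr_gt0.
have [y yA xy] := xlim _ e2; have [t yt] := yA _ e2; exists t => k.
by apply: le_trans (rnormrB_trans (y k) _ _) _; rewrite (splitr e) lerD.
Qed.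

Lemma term_approxD x y :
  term_approx x -> term_approx y -> term_approx (fun k => x k + y k).
Proof.
move=> xA yA e e0; have e2 : 0 < e / 2 by rewrite divr_gt0.
have [s xs] := xA _ e2; have [t yt] := yA _ e2; exists (TAdd s t) => k /=.
rewrite opprD addrACA (splitr e).
by apply: le_trans (rnormrD _ _) _; rewrite lerD.
Qed.

Lemma term_approxZ (c : R[i]) x :
  term_approx x -> term_approx (fun k => c *: x k).
Proof.
move=> xA e e0; have c1 : 0 < cabs c + 1 by rewrite ltr_wpDl ?cabs_ge0.
have [t xt] := xA (e / (cabs c + 1)) ltac:(by rewrite divr_gt0).
exists (TScale c t) => k /=; rewrite -scalerBr rnormrZ.
apply: le_trans (ler_wpM2l (cabs_ge0 c) (xt k)) _.
by rewrite mulrCA ler_piMr ?(ltW e0)// ler_pdivrMr// mul1r lerDl.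
Qed.

Lemma term_approxN x : term_approx x -> term_approx (fun k => - x k).
Proof.
move=> xA; apply: term_approx_ext (term_approxZ (-1) xA) => k.
exact: scaleN1r.
Qed.

Lemma term_approx_adj x : term_approx x -> term_approx (fun k => adj (x k)).
Proof.
move=> xA e e0; have [t xt] := xA e e0; exists (TAdj t) => k /=.
by rewrite -adjB rnormr_adj.
Qed.

Lemma term_approx1 : term_approx (fun k => 1).
Proof. exact: (term_approx_eval TOne). Qed.

Lemma term_approx0 : term_approx (fun k => 0).
Proof.
apply: term_approx_ext (term_approxZ 0 term_approx1) => k.
exact: scale0r.
Qed.

Lemma term_approx_bounded x : term_approx x ->
  exists2 b : R, 0 <= b & forall k, rnormr (x k) <= b.
Proof.
move=> xA; have [t xt] := xA 1 ltr01.
exists (1 + `|term_bound t|) => [|k]; first by rewrite addr_ge0.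
rewrite -(subrK (term_eval (leg k) t) (x k)).
apply: le_trans (rnormrD _ _) _; rewrite lerD//.
by apply: le_trans (term_eval_le _ _) _; apply: ler_norm.
Qed.

Lemma term_approxM x y :
  term_approx x -> term_approx y -> term_approx (fun k => x k * y k).
Proof.
move=> xA yA; have [b b0 xb] := term_approx_bounded xA.
(* Two stages: [x y] is a limit of [x t] for terms [t], because [x] is bounded; each [x t] is a
   limit of products of terms, because [t] is bounded. *)
apply: term_approx_lim => e e0.
have b1 : 0 < b + 1 by rewrite ltr_wpDl.
have [t yt] := yA (e / (b + 1)) ltac:(by rewrite divr_gt0).
exists (fun k => x k * term_eval (leg k) t) => [|k]; last first.
  rewrite -mulrBr; apply: le_trans (rnormrM _ _) _.
  apply: le_trans (ler_pM (rnormr_ge0 _) (rnormr_ge0 _) (xb k) (yt k)) _.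
  by rewrite mulrCA ler_piMr ?(ltW e0)// ler_pdivrMr// mul1r lerDl.
have [c c0 tc] := term_approx_bounded (term_approx_eval t).
have c1 : 0 < c + 1 by rewrite ltr_wpDl.
move=> d d0; have [s xs] := xA (d / (c + 1)) ltac:(by rewrite divr_gt0).
exists (TMul s t) => k /=; rewrite -mulrBl; apply: le_trans (rnormrM _ _) _.
apply: le_trans (ler_pM (rnormr_ge0 _) (rnormr_ge0 _) (xs k) (tc k)) _.
rewrite -mulrA [_^-1 * _]mulrC ler_piMr ?(ltW d0)//.
by rewrite ler_pdivrMr// mul1r lerDl.
Qed.

Record uclos := UClos { ufun :> forall k, M k; uclosP : term_approx ufun }.

Lemma uclos_eq (x y : uclos) : (forall k, x k = y k) -> x = y.
Proof.
case: x y => [x xA] [y yA] /= xy.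
have {xy} E : x = y by apply: functional_extensionality_dep.
by case: _ / E in yA *; congr UClos; apply: Prop_irrelevance.
Qed.

HB.instance Definition _ := gen_eqMixin uclos.
HB.instance Definition _ := gen_choiceMixin uclos.

Definition uclos_zero := UClos term_approx0.
Definition uclos_one := UClos term_approx1.
Definition uclos_add (x y : uclos) :=
  UClos (term_approxD (uclosP x) (uclosP y)).
Definition uclos_opp (x : uclos) := UClos (term_approxN (uclosP x)).
Definition uclos_scale (c : R[i]) (x : uclos) :=
  UClos (term_approxZ c (uclosP x)).
Definition uclos_mul (x y : uclos) :=
  UClos (term_approxM (uclosP x) (uclosP y)).
Definition uclos_adj (x : uclos) := UClos (term_approx_adj (uclosP x)).

Fact uclos_addA : associative uclos_add.
Proof. by move=> x y z; apply: uclos_eq => k; exact: addrA. Qed.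
Fact uclos_addC : commutative uclos_add.
Proof. by move=> x y; apply: uclos_eq => k; exact: addrC. Qed.
Fact uclos_add0 : left_id uclos_zero uclos_add.
Proof. by move=> x; apply: uclos_eq => k; exact: add0r. Qed.
Fact uclos_addN : left_inverse uclos_zero uclos_opp uclos_add.
Proof. by move=> x; apply: uclos_eq => k; exact: addNr. Qed.

HB.instance Definition _ := GRing.isZmodule.Build uclos
  uclos_addA uclos_addC uclos_add0 uclos_addN.

Fact uclos_scaleA (a b : R[i]) (x : uclos) :
  uclos_scale a (uclos_scale b x) = uclos_scale (a * b) x.
Proof. by apply: uclos_eq => k; exact: scalerA. Qed.
Fact uclos_scale1 : left_id 1 uclos_scale.
Proof. by move=> x; apply: uclos_eq => k; exact: scale1r. Qed.
Fact uclos_scaleDr : right_distributive uclos_scale +%R.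
Proof. by move=> a x y; apply: uclos_eq => k; exact: scalerDr. Qed.
Fact uclos_scaleDl (x : uclos) :
  {morph uclos_scale^~ x : a b / a + b}.
Proof. by move=> a b; apply: uclos_eq => k; exact: scalerDl. Qed.

HB.instance Definition _ := GRing.Zmodule_isLmodule.Build R[i] uclos
  uclos_scaleA uclos_scale1 uclos_scaleDr uclos_scaleDl.

Implicit Types u v w : uclos.

Definition unorm u : R := sup (range (fun k => rnormr (u k))).

Lemma unorm_ub u k : rnormr (u k) <= unorm u.
Proof.
apply: ub_le_sup; last by exists k.
by have [b _ ub] := term_approx_bounded (uclosP u); exists b => _ [l _ <-].
Qed.

(** Nonnegativity of [b] serves the case of empty [K], where the supremum is 0 by convention. *)
Lemma unorm_le u (b : R) :
  0 <= b -> (forall k, rnormr (u k) <= b) -> unorm u <= b.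
Proof.
move=> b0 ub; have [[k _]|K0] := pselect (exists k : K, True).
  by apply: ge_sup => [|_ [l _ <-]//]; exists (rnormr (u k)), k.
by rewrite /unorm sup_out// => -[[_ [k _ _]] _]; apply: K0; exists k.
Qed.

Lemma unorm_ge0 u : 0 <= unorm u.
Proof.
have [[k _]|K0] := pselect (exists k : K, True).
  exact: le_trans (rnormr_ge0 _) (unorm_ub u k).
by rewrite /unorm sup_out// => -[[_ [k _ _]] _]; apply: K0; exists k.
Qed.

Fact unormD u v : unorm (u + v) <= unorm u + unorm v.
Proof.
apply: unorm_le => [|k]; first by rewrite addr_ge0 ?unorm_ge0.
by apply: le_trans (rnormrD _ _) _; rewrite lerD ?unorm_ub.
Qed.

Fact unormZ_le (c : R[i]) u : unorm (c *: u) <= cabs c * unorm u.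
Proof.
apply: unorm_le => [|k]; first by rewrite mulr_ge0 ?unorm_ge0 ?cabs_ge0.
by rewrite [leLHS]rnormrZ ler_wpM2l ?cabs_ge0 ?unorm_ub.
Qed.

Fact unormZ (c : R[i]) u : (unorm (c *: u))%:C = `|c| * (unorm u)%:C.
Proof.
rewrite -cabsE -rmorphM /=; congr (_%:C); apply/eqP.
rewrite eq_le unormZ_le /=.
have [->|c0] := eqVneq c 0.
  by rewrite /cabs normr0 /= mul0r unorm_ge0.
have ac0 : 0 < cabs c by rewrite -ltcR cabsE normr_gt0.
rewrite -ler_pdivlMl//.
have -> : (cabs c)^-1 = cabs c^-1.
  by apply: complexI; rewrite fmorphV /= !cabsE normfV.
by rewrite -[X in unorm X](scalerK c0) unormZ_le.
Qed.

Fact unorm0_eq0 u : unorm u = 0 -> u = 0.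
Proof.
move=> u0; apply: uclos_eq => k; apply/rnormr_eq0/eqP.
by rewrite eq_le rnormr_ge0 andbT -u0 unorm_ub.
Qed.

Fact unorm_complete (u : nat -> uclos) :
  (forall e : R, 0 < e -> exists N, forall m n, (N <= m)%N -> (N <= n)%N ->
     unorm (u m - u n) < e) ->
  exists l, forall e : R, 0 < e -> exists N, forall n, (N <= n)%N ->
     unorm (u n - l) < e.
Proof.
move=> u_cauchy.
have lim k : exists l : M k, forall e : R, 0 < e ->
    exists N, forall n, (N <= n)%N -> rnormr (u n k - l) <= e.
  have [e e0|l _ lP] := @complete_seq_cvg R (M k) (fun n => u n k).
    have [N NP] := u_cauchy e e0; exists N => m n Nm Nn.
    rewrite -rnormrE ltcR; apply: le_lt_trans (NP m n Nm Nn).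
    exact: (unorm_ub (u m - u n)).
  exists l => e e0; have [N NP] := lP e e0; exists N => n Nn.
  by rewrite -lecR rnormrE ltW// NP.
pose g k : M k := projT1 (cid (lim k)).
have ug (e : R) : 0 < e -> exists N, forall n, (N <= n)%N ->
    forall k, rnormr (u n k - g k) <= e.
  move=> e0; have e2 : 0 < e / 2 by rewrite divr_gt0.
  have [N NP] := u_cauchy _ e2; exists N => n Nn k.
  have [N' N'P] := projT2 (cid (lim k)) _ e2.
  apply: le_trans (rnormrB_trans (u (maxn N N') k) _ _) _.
  rewrite (splitr e) lerD//; last by apply: N'P; rewrite leq_maxr.
  apply/ltW; apply: le_lt_trans (NP n (maxn N N') Nn (leq_maxl _ _)).
  exact: (unorm_ub (u n - u (maxn N N'))).
have gA : term_approx g.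
  apply: term_approx_lim => e e0; have [N NP] := ug e e0.
  exists (u N) => [|k]; first exact: uclosP.
  by rewrite rnormrBC NP.
exists (UClos gA) => e e0; have e2 : 0 < e / 2 by rewrite divr_gt0.
have [N NP] := ug _ e2; exists N => n Nn.
apply: (@le_lt_trans _ _ (e / 2)); last first.
  by rewrite ltr_pdivrMr// ltr_pMr// ltr1n.
by apply: unorm_le => [|k]; [exact: ltW|exact: NP].
Qed.

HB.instance Definition _ := Lmodule_isCompleteNormed.Build R uclos
  unormD unormZ unorm0_eq0 unorm_complete.

Let unormE u : `|u| = (unorm u)%:C. Proof. by []. Qed.

Fact uclos_mulA : associative uclos_mul.
Proof. by move=> x y z; apply: uclos_eq => k; exact: mulrA. Qed.
Fact uclos_mul1 : left_id uclos_one uclos_mul.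
Proof. by move=> x; apply: uclos_eq => k; exact: mul1r. Qed.
Fact uclos_mulr1 : right_id uclos_one uclos_mul.
Proof. by move=> x; apply: uclos_eq => k; exact: mulr1. Qed.
Fact uclos_mulDl : left_distributive uclos_mul +%R.
Proof. by move=> x y z; apply: uclos_eq => k; exact: mulrDl. Qed.
Fact uclos_mulDr : right_distributive uclos_mul +%R.
Proof. by move=> x y z; apply: uclos_eq => k; exact: mulrDr. Qed.
Fact uclos_scaleAl (c : R[i]) u v :
  c *: uclos_mul u v = uclos_mul (c *: u) v.
Proof. by apply: uclos_eq => k; exact: calg_scaleAl. Qed.
Fact uclos_scaleAr (c : R[i]) u v :
  c *: uclos_mul u v = uclos_mul u (c *: v).
Proof. by apply: uclos_eq => k; exact: calg_scaleAr. Qed.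
Fact uclos_adjK : involutive uclos_adj.
Proof. by move=> x; apply: uclos_eq => k; exact: adjK. Qed.
Fact uclos_adjD : {morph uclos_adj : u v / u + v}.
Proof. by move=> x y; apply: uclos_eq => k; exact: adjD. Qed.
Fact uclos_adjZ (c : R[i]) u : uclos_adj (c *: u) = conjc c *: uclos_adj u.
Proof. by apply: uclos_eq => k; exact: adjZ. Qed.
Fact uclos_adjM u v :
  uclos_adj (uclos_mul u v) = uclos_mul (uclos_adj v) (uclos_adj u).
Proof. by apply: uclos_eq => k; exact: adjM. Qed.

Fact uclos_normM u v : `|uclos_mul u v| <= `|u| * `|v|.
Proof.
rewrite !unormE -rmorphM lecR; apply: unorm_le => [|k].
  by rewrite mulr_ge0 ?unorm_ge0.
by apply: le_trans (rnormrM _ _) _; rewrite ler_pM ?rnormr_ge0 ?unorm_ub.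
Qed.

Fact uclos_norm_adj u : `|uclos_mul (uclos_adj u) u| = `|u| ^+ 2.
Proof.
rewrite !unormE -rmorphXn; congr (_%:C); apply/eqP; rewrite eq_le.
apply/andP; split.
  apply: unorm_le => [|k]; first by rewrite exprn_ge0 ?unorm_ge0.
  rewrite [leLHS]rnormr_adjM ler_pXn2r ?nnegrE ?unorm_ge0 ?rnormr_ge0//.
  exact: unorm_ub.
(* Conversely, each [|u k|^2 = |w k|] is at most the norm of [w]; square roots turn this into a
   bound on the supremum. *)
set w := uclos_mul _ _; have w0 : 0 <= unorm w by exact: unorm_ge0.
rewrite -[leRHS]sqr_sqrtr// ler_pXn2r ?nnegrE ?sqrtr_ge0 ?unorm_ge0//.
apply: unorm_le => [|k]; first by rewrite sqrtr_ge0.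
rewrite -(ler_pXn2r (n := 2))// ?nnegrE ?sqrtr_ge0 ?rnormr_ge0// sqr_sqrtr//.
by rewrite -rnormr_adjM; exact: (unorm_ub w).
Qed.

Definition uclos_cstar : cstarAlgType R :=
  @CstarAlgType R uclos uclos_mul uclos_one uclos_adj uclos_mulA uclos_mul1
    uclos_mulr1 uclos_mulDl uclos_mulDr uclos_scaleAl uclos_scaleAr
    uclos_adjK uclos_adjD uclos_adjZ uclos_adjM uclos_normM uclos_norm_adj.

Definition uclos_eval (t : star_term) : uclos_cstar :=
  UClos (term_approx_eval t).

Section Generators.
Context (i : I).

Definition uclos_leg_fun (x : D i) : uclos_cstar := uclos_eval (TGen x).

Fact uclos_leg_linear : linear uclos_leg_fun.
Proof. by move=> c x y; apply: uclos_eq => k; exact: starHom_linear. Qed.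
Fact uclos_leg_monoid : monoid_morphism uclos_leg_fun.
Proof.
split=> [|x y]; apply: uclos_eq => k; [exact: starHom1|exact: starHomM].
Qed.
Fact uclos_leg_star : {morph uclos_leg_fun : x / star x}.
Proof. by move=> x; apply: uclos_eq => k; exact: starHom_star. Qed.

Definition uclos_leg : starHom (D i) uclos_cstar :=
  StarHom uclos_leg_linear uclos_leg_monoid uclos_leg_star.
End Generators.

Lemma term_eval_uclos (t : star_term) : term_eval uclos_leg t = uclos_eval t.
Proof.
elim: t => //= [|s IHs t IHt|c t IHt|s IHs t IHt|t IHt];
  rewrite ?IHs ?IHt; exact: uclos_eq.
Qed.

Lemma uclos_dense (u : uclos_cstar) (e : R) : 0 < e ->
  exists t, rnormr (u - term_eval uclos_leg t) <= e.
Proof.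
move=> e0; have [t ut] := uclosP u e0; exists t; rewrite term_eval_uclos.
by apply: unorm_le => [|k]; [exact: ltW|exact: ut].
Qed.

(** Terms are dense and homomorphisms contractive, so agreement on generators propagates to the
    closure. *)
Lemma uclos_hom_unique (N : cstarAlgType R) (h h' : starHom uclos_cstar N) :
  (forall i, h \o uclos_leg i =1 h' \o uclos_leg i) -> h =1 h'.
Proof.
move=> hh' u; apply/subr0_eq/rnormr_small => e e0.
have e2 : 0 < e / 2 by rewrite divr_gt0.
have [t ut] := uclos_dense u e2.
have ht : h (term_eval uclos_leg t) = h' (term_eval uclos_leg t).
  rewrite (@term_eval_comp _ _ h _ (fun i => star_comp h (uclos_leg i)))//.
  rewrite (@term_eval_comp _ _ h' _ (fun i => star_comp h (uclos_leg i)))//.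
  by move=> i x; rewrite -hh'.
apply: le_trans (rnormrB_trans (h (term_eval uclos_leg t)) _ _) _.
rewrite (splitr e) lerD//.
  by rewrite -starHomB (le_trans (starHom_le _ _)).
rewrite ht -starHomB; apply: le_trans (starHom_le _ _) _.
by rewrite rnormrBC.
Qed.

End UniformClosure.

(** * Colimits of diagrams presented by relations between elements *)

Section Colimit.
Context (R : realType) (I : Type) (D : I -> cstarAlgType R).
Context (rel : forall i j, D i -> D j -> Prop).

(** An arbitrary relation between elements covers both pushouts and colimits over a poset. *)
Definition is_rel_cocone (M : cstarAlgType R)
    (leg : forall i, starHom (D i) M) : Prop :=
  forall i j (x : D i) (y : D j), rel x y -> leg i x = leg j y.

(* Algebras under the diagram form a proper class, but the norm functions they
   induce on terms form a set. *)
Definition cocone_norm : Type :=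
  {p : star_term D -> R | exists M (leg : forall i, starHom (D i) M),
     is_rel_cocone leg /\ forall t, rnormr (term_eval leg t) = p t}.

Definition norm_alg (p : cocone_norm) : cstarAlgType R :=
  projT1 (cid (projT2 p)).

Definition norm_leg (p : cocone_norm) :
    forall i, starHom (D i) (norm_alg p) :=
  projT1 (cid (projT2 (cid (projT2 p)))).

Lemma norm_legP (p : cocone_norm) : is_rel_cocone (norm_leg p) /\
  forall t, rnormr (term_eval (norm_leg p) t) = projT1 p t.
Proof. exact: projT2 (cid (projT2 (cid (projT2 p)))). Qed.

Definition colim_alg : cstarAlgType R := uclos_cstar norm_leg.

Definition colim_alg_leg i : starHom (D i) colim_alg := uclos_leg norm_leg i.

Lemma colim_alg_cocone : is_rel_cocone colim_alg_leg.
Proof.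
by move=> i j x y xy; apply: uclos_eq => p; apply: (norm_legP p).1.
Qed.

Section Mediator.
Context (M : cstarAlgType R) (leg : forall i, starHom (D i) M).
Hypothesis leg_cocone : is_rel_cocone leg.

(** The target [M] becomes one more factor of the product, at the index [None]. *)
Definition mediator_alg (o : option cocone_norm) : cstarAlgType R :=
  if o is Some p then norm_alg p else M.

Definition mediator_leg (o : option cocone_norm) :
    forall i, starHom (D i) (mediator_alg o) :=
  if o is Some p then norm_leg p else leg.

Definition mediator_pair (u : colim_alg) (z : M) (o : option cocone_norm) :
    mediator_alg o :=
  if o is Some p then ufun u p else z.

(** The graph of the mediating map: [z] belongs to [u] when adjoining it at [None] keeps the family
    a uniform limit of terms. *)
Definition mediates (u : colim_alg) (z : M) : Prop :=
  term_approx mediator_leg (mediator_pair u z).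

(** The index of the norm function of the given cocone. The algebra chosen there may differ from
    [M], but every term has the same norm in both. *)
Let p0 : cocone_norm.
Proof.
by exists (fun t => rnormr (term_eval leg t)), M, leg.
Defined.

Let norm_p0 t : rnormr (term_eval leg t) = rnormr (term_eval (norm_leg p0) t).
Proof. by rewrite (norm_legP p0).2. Qed.

Let mediates_ex u : exists z, mediates u z.
Proof.
have h01 : 0 <= (2^-1 : R) < 1 by lra.
have hn n : 0 < (2^-1 : R) ^+ n by rewrite exprn_gt0 ?invr_gt0.
(* The approximating terms are Cauchy in the factor at [p0], hence in [M], and [z] is their limit
   there. *)
have [t tP] := boolp.choice (fun n => uclosP u (hn n)).
have tM n :
    rnormr (term_eval leg (t n.+1) - term_eval leg (t n)) <= 2 * 2^-1 ^+ n.
  (* A difference of term values is itself the value of a term, so [norm_p0] applies to it. *)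
  have /= := norm_p0 (TAdd (t n.+1) (TScale (-1) (t n))).
  rewrite !scaleN1r => ->.
  apply: le_trans (rnormrB_trans (ufun u p0) _ _) _.
  rewrite mulr_natl mulr2n lerD// rnormrBC; apply: le_trans (tP _ _) _.
  by rewrite exprS ler_piMl ?(ltW (hn n))//; lra.
have [z zP] := geometric_cvg h01 tM.
exists z => e e0.
have [n nP] := expr_small (2 / (1 - 2^-1) + 1) h01 e0.
exists (t n) => -[p|] /=; apply: le_trans nP.
  apply: le_trans (tP n p) _; rewrite ler_peMl ?(ltW (hn n))// lerDr.
  by rewrite divr_ge0//; lra.
rewrite rnormrBC; apply: le_trans (zP n) _.
by rewrite ler_wpM2r ?(ltW (hn n))// lerDl.
Qed.

Let mediates_unique u z z' : mediates u z -> mediates u z' -> z = z'.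
Proof.
move=> uz uz'; apply/subr0_eq/rnormr_small => e e0.
have e2 : 0 < e / 2 by rewrite divr_gt0.
(* The family with [z - z'] at [None] and 0 elsewhere is approximated by a term; that term is small
   at [p0], hence also in [M]. *)
have [t tP] := term_approxD uz (term_approxN uz') e2.
have /= := tP (Some p0); rewrite subrr sub0r rnormrN -norm_p0 => t0.
rewrite -(subrK (term_eval leg t) (z - z')); apply: le_trans (rnormrD _ _) _.
by rewrite (splitr e) lerD//; exact: (tP None).
Qed.

Definition mediator_fun (u : colim_alg) : M := projT1 (cid (mediates_ex u)).

Let mediatesP u : mediates u (mediator_fun u).
Proof. exact: projT2 (cid (mediates_ex u)). Qed.

(** [mediates] is closed under the algebra operations, so single-valuedness yields each homomorphism
    law below. *)
Let mediator_funE u z : mediates u z -> mediator_fun u = z.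
Proof. exact: mediates_unique. Qed.

Fact mediator_linear : linear mediator_fun.
Proof.
move=> c u v; apply: mediator_funE.
by apply: term_approx_ext (term_approxD (term_approxZ c (mediatesP u))
  (mediatesP v)) => -[].
Qed.

Fact mediator_monoid : monoid_morphism mediator_fun.
Proof.
split=> [|u v]; apply: mediator_funE.
  by apply: term_approx_ext (@term_approx1 _ _ _ _ _ mediator_leg) => -[].
by apply: term_approx_ext (term_approxM (mediatesP u) (mediatesP v)) => -[].
Qed.

Fact mediator_star : {morph mediator_fun : u / star u}.
Proof.
move=> u; apply: mediator_funE.
by apply: term_approx_ext (term_approx_adj (mediatesP u)) => -[].
Qed.

Definition mediator : starHom colim_alg M :=
  StarHom mediator_linear mediator_monoid mediator_star.

Lemma mediator_colim_leg i : mediator \o colim_alg_leg i =1 leg i.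
Proof.
move=> x; apply: mediator_funE.
by apply: term_approx_ext (term_approx_eval mediator_leg (TGen x)) => -[].
Qed.

End Mediator.

Theorem rel_colimit_exists :
  exists (Q : cstarAlgType R) (leg : forall i, starHom (D i) Q),
    is_rel_cocone leg /\
    forall (M : cstarAlgType R) (leg' : forall i, starHom (D i) M),
      is_rel_cocone leg' ->
      exists h : starHom Q M, (forall i, h \o leg i =1 leg' i) /\
        forall h' : starHom Q M, (forall i, h' \o leg i =1 leg' i) -> h' =1 h.
Proof.
exists colim_alg, colim_alg_leg; split; first exact: colim_alg_cocone.
move=> M leg' leg'P; exists (mediator leg'P); split=> [i|h' h'P].
  exact: mediator_colim_leg.
by apply: uclos_hom_unique => i x; rewrite [LHS]h'P [RHS]mediator_colim_leg.
Qed.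

End Colimit.

(** * Commutative subalgebras and universal families *)

Section SpectrumTheory.
Context (R : realType).
Implicit Types C D E : cstarAlgType R.

Lemma spectrum_eq C (chi chi' : spectrum C) : chi =1 chi' -> chi = chi'.
Proof.
case: chi chi' => [f l m s] [f' l' m' s'] /= /funext ff'.
by case: _ / ff' in l' m' s' *; congr Character; apply: Prop_irrelevance.
Qed.

Lemma ell_map_id C (f : starHom C C) : f =1 id -> ell_map f =1 id.
Proof.
move=> f1 x; apply: linfP => chi /=; congr (linf_fun x _).
by apply: spectrum_eq => c /=; rewrite f1.
Qed.

Lemma ell_map_comp C D E (f : starHom C D) (g : starHom D E)
    (h : starHom C E) :
  g \o f =1 h -> ell_map g \o ell_map f =1 ell_map h.
Proof.
move=> gf x; apply: linfP => chi /=; congr (linf_fun x _).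
by apply: spectrum_eq => c /=; rewrite -gf.
Qed.

Lemma ell_map_gelfand C D (f : starHom C D) :
  ell_map f \o gelfand C =1 gelfand D \o f.
Proof. by move=> c; apply: linfP. Qed.

End SpectrumTheory.

Section Subalgebras.
Context (R : realType).
Implicit Types A B : cstarAlgType R.

(** The image is the whole range of [f] composed with the inclusion of [C], and ranges of
    homomorphisms are closed. *)
Fact img_sub_closed A B (f : starHom A B) (C : comSubalg A) :
  closed (f @` csub_set C).
Proof.
have -> : f @` csub_set C = range (star_comp f (csub_hom C)).
  apply/seteqP; split=> y [x].
    by move=> Cx <-; exists (Csub (introT (csub_predP C x) Cx)).
  by move=> _ <-; exists (csub_val x) => //; exact: csubP.
exact: starHom_image_closed.
Qed.

Definition img_sub A B (f : starHom A B) (C : comSubalg A) : comSubalg B.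
Proof.
apply: (@ComSubalg R B (f @` csub_set C)); last 2 first.
- exact: img_sub_closed.
- by move=> _ _ [x Cx <-] [y Cy <-]; rewrite -!starHomM (csub_comm Cx Cy).
- by exists 1; [exact: csub_1|exact: starHom1].
- move=> _ _ [x Cx <-] [y Cy <-]; exists (x + y); first exact: csub_D.
  exact: starHomD.
- move=> k _ [x Cx <-]; exists (k *: x); first exact: csub_Z.
  exact: starHomZ.
- move=> _ _ [x Cx <-] [y Cy <-]; exists (x * y); first exact: csub_M.
  exact: starHomM.
- move=> _ [x Cx <-]; exists (star x); first exact: csub_star.
  exact: starHom_star.
Defined.

Lemma img_subP A B (f : starHom A B) (C : comSubalg A) x :
  csub_set C x -> csub_set (img_sub f C) (f x).
Proof. by move=> Cx; exists x. Qed.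

Lemma img_sub_le A B (f : starHom A B) (C : comSubalg A) (D : comSubalg B) :
  (forall x, csub_set C x -> csub_set D (f x)) ->
  csub_set (img_sub f C) `<=` csub_set D.
Proof. by move=> fCD _ [x Cx <-]; exact: fCD. Qed.

Definition full_sub A (cA : is_commutative A) : comSubalg A :=
  @ComSubalg R A setT I (fun _ _ _ _ => I) (fun _ _ _ => I)
    (fun _ _ _ _ => I) (fun _ _ => I) closedT (fun x y _ _ => cA x y).

Section FullSubalgebra.
Context (A : cstarAlgType R) (cA : is_commutative A).

Fact to_full_subproof (x : A) : x \in csub_pred (full_sub cA).
Proof. exact/csub_predP. Qed.
Definition to_full_fun (x : A) : csub_cstar (full_sub cA) :=
  Csub (to_full_subproof x).
Fact to_full_linear : linear to_full_fun.
Proof. by move=> k x y; exact: csub_inj. Qed.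
Fact to_full_monoid : monoid_morphism to_full_fun.
Proof. by split=> [|x y]; exact: csub_inj. Qed.
Fact to_full_star : {morph to_full_fun : x / star x}.
Proof. by move=> x; exact: csub_inj. Qed.
Definition to_full : starHom A (csub_cstar (full_sub cA)) :=
  StarHom to_full_linear to_full_monoid to_full_star.

End FullSubalgebra.

(** The complex numbers, realized as the functions on a one-point set. *)
Definition cplx : cstarAlgType R := linf_cstar R unit.

Lemma cplx_comm : is_commutative cplx.
Proof. by move=> x y; apply: linfP => t; exact: mulrC. Qed.

Section Constants.
Context (A : cstarAlgType R).
Definition scalar_fun (z : cplx) : A := linf_fun z tt *: (1 : A).
Fact scalar_fun_linear : linear scalar_fun.
Proof. by move=> k x y; rewrite /scalar_fun scalerA -scalerDl. Qed.
Fact scalar_fun_monoid : monoid_morphism scalar_fun.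
Proof.
split=> [|x y]; first exact: scale1r.
by rewrite /scalar_fun scalarM.
Qed.
Fact scalar_fun_star : {morph scalar_fun : z / star z}.
Proof.
move=> z; rewrite -[RHS]/(adj (scalar_fun z)) /scalar_fun adjZ adj1.
by [].
Qed.
Definition scalar_hom : starHom cplx A :=
  StarHom scalar_fun_linear scalar_fun_monoid scalar_fun_star.

(** The least commutative subalgebra; it gives every [A] a stage at which [eta] can be read off. *)
Definition scalar_sub : comSubalg A := img_sub scalar_hom (full_sub cplx_comm).

Lemma scalar_sub_le (C : comSubalg A) : csub_set scalar_sub `<=` csub_set C.
Proof. by move=> _ [z _ <-]; apply/csub_Z/csub_1. Qed.
End Constants.

End Subalgebras.

(** * Pushouts and the universal compatible family *)

Section Pushouts.
Context (R : realType).

Section Existence.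
Context (C A B : cstarAlgType R) (f : starHom C A) (g : starHom C B).

Definition span (b : bool) : cstarAlgType R := if b then A else B.

Inductive span_rel : forall i j, span i -> span j -> Prop :=
| SpanRel c : @span_rel true false (f c) (g c).

Lemma pushout_exists : exists (P : cstarAlgType R) (i : starHom A P)
  (j : starHom B P), is_pushout f g i j.
Proof.
have [P [leg [legP univ]]] := rel_colimit_exists span_rel.
exists P, (leg true), (leg false); split=> [c|M u v uv].
  exact: legP (SpanRel c).
pose leg' b : starHom (span b) M :=
  if b return starHom (span b) M then u else v.
have [|h [hP h_unique]] := univ M leg'; first by move=> _ _ _ _ [c]; exact: uv.
exists h; split=> [|| h' h'u h'v]; [exact: (hP true)|exact: (hP false)|].
by apply: h_unique => -[].
Qed.
End Existence.

Lemma pushout_hom_ext (C A B P M : cstarAlgType R) (f : starHom C A)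
    (g : starHom C B) (i : starHom A P) (j : starHom B P)
    (h h' : starHom P M) :
  is_pushout f g i j -> h \o i =1 h' \o i -> h \o j =1 h' \o j -> h =1 h'.
Proof.
move=> [ij univ] hi hj.
have [|k [_ _ k_unique]] := univ M (star_comp h i) (star_comp h j).
  by move=> c /=; rewrite [i _]ij.
move=> x; rewrite (k_unique h)// (k_unique h')// => y.
  exact/esym/hi.
exact/esym/hj.
Qed.

End Pushouts.

Section UniversalFamily.
Context (R : realType).

Definition is_universal (A Q : cstarAlgType R) (eta : starHom A Q)
    (l : forall C : comSubalg A, starHom (ell C) Q) : Prop :=
  compatible_family eta l /\
  forall (M : cstarAlgType R) (phi : starHom A M)
    (phi_ : forall C : comSubalg A, starHom (ell C) M),
    compatible_family phi phi_ ->
    exists psi : starHom Q M,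
      [/\ psi \o eta =1 phi, forall C, psi \o l C =1 phi_ C
        & forall psi' : starHom Q M, psi' \o eta =1 phi ->
            (forall C, psi' \o l C =1 phi_ C) -> psi' =1 psi].

Lemma compatible_comp (A M N : cstarAlgType R) (phi : starHom A M)
    (phi_ : forall C : comSubalg A, starHom (ell C) M) (h : starHom M N) :
  compatible_family phi phi_ ->
  compatible_family (star_comp h phi) (fun C => star_comp h (phi_ C)).
Proof.
move=> [phiE phi_E]; split=> [C x|C D CD x] /=.
  by have /= -> := phiE C x.
by congr (h _); exact: phi_E.
Qed.

Lemma universal_hom_ext (A Q M : cstarAlgType R) (eta : starHom A Q)
    (l : forall C : comSubalg A, starHom (ell C) Q) (h h' : starHom Q M) :
  is_universal eta l -> h \o eta =1 h' \o eta ->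
  (forall C, h \o l C =1 h' \o l C) -> h =1 h'.
Proof.
move=> [lE univ] h_eta hl.
have [k [_ _ k_unique]] := univ _ _ _ (compatible_comp h lE).
move=> x; rewrite (k_unique h)// (k_unique h')// => [y|C y].
  exact/esym/h_eta.
exact/esym/hl.
Qed.

Context (A : cstarAlgType R).

(** A homomorphism out of [A *_C L(C)] is a pair of maps agreeing on [C], so a cocone over the
    pushouts with a common restriction to [A] amounts to a compatible family. *)
Lemma colimit_universal (P : amalgams A) (Q : cstarAlgType R)
    (leg : forall C, starHom (P C) Q) (eta : starHom A Q) :
  is_colimit leg -> (forall C, leg C \o amalg_l P C =1 eta) ->
  is_universal eta (fun C => star_comp (leg C) (amalg_r P C)).
Proof.
move=> [legE univ] etaE; split; first split=> [C x|C D CD x] /=.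
- have /= <- := (amalg_pushout P C).1 x; exact: etaE.
- have /= <- := amalg_map_r P CD x; exact/esym/legE.
move=> M phi phi_ [phiE phi_E].
have gP C : exists g : starHom (P C) M,
    g \o amalg_l P C =1 phi /\ g \o amalg_r P C =1 phi_ C.
  have [|g [gl gr _]] := (amalg_pushout P C).2 M phi (phi_ C).
    by move=> x; exact/esym/phiE.
  by exists g.
pose g C := projT1 (cid (gP C)).
have gl C : g C \o amalg_l P C =1 phi := (projT2 (cid (gP C))).1.
have gr C : g C \o amalg_r P C =1 phi_ C := (projT2 (cid (gP C))).2.
have [|psi [psiP psi_unique]] := univ M g.
  move=> C D CD.
  apply: (pushout_hom_ext (h := star_comp (g D) (amalg_map P CD))
    (amalg_pushout P C)) => x /=.
    by rewrite [amalg_map _ _ _]amalg_map_l [LHS]gl [RHS]gl.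
  by rewrite [amalg_map _ _ _]amalg_map_r [LHS]gr [RHS]gr [RHS](phi_E _ _ CD).
exists psi; split=> [x|C x|psi' psi'E psi'l] /=.
- by rewrite -(etaE (scalar_sub A)) [LHS]psiP [LHS]gl.
- by rewrite [LHS]psiP [LHS]gr.
- apply: psi_unique => C.
  apply: (pushout_hom_ext (h := star_comp psi' (leg C))
    (amalg_pushout P C)) => x /=.
    by rewrite [leg C _]etaE [LHS]psi'E [RHS]gl.
  by rewrite [LHS]psi'l [RHS]gr.
Qed.

End UniversalFamily.

(** * Existence of the colimit functor *)

Section Existence.
Context (R : realType).

Lemma amalgams_exist (A : cstarAlgType R) : inhabited (amalgams A).
Proof.
have po (C : comSubalg A) : {P : cstarAlgType R & {i : starHom A P &
    {j : starHom (ell C) P | is_pushout (csub_hom C) (gelfand C) i j}}}.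
  have /cid[P /cid[i /cid[j ijP]]] := pushout_exists (csub_hom C) (gelfand C).
  by exists P, i, j.
pose P C := projT1 (po C); pose l C := projT1 (projT2 (po C)).
pose r C := projT1 (projT2 (projT2 (po C))).
have lrP C : is_pushout (csub_hom C) (gelfand C) (l C) (r C) :=
  projT2 (projT2 (projT2 (po C))).
have map_ex (C D : comSubalg A) (CD : csub_set C `<=` csub_set D) :
    exists m : starHom (P C) (P D),
    m \o l C =1 l D /\ m \o r C =1 r D \o ell_map (csub_incl CD).
  have [|m [ml mr _]] := (lrP C).2 _ (l D)
      (star_comp (r D) (ell_map (csub_incl CD))).
    move=> x; apply: etrans ((lrP D).1 (csub_incl CD x)) _.
    by congr (r D _); exact/esym/ell_map_gelfand.
  by exists m.
pose m C D CD := projT1 (cid (map_ex C D CD)).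
have mP C D CD := projT2 (cid (map_ex C D CD)).
split; exact: (@Amalgams R A P l r lrP m
  (fun C D CD => (mP C D CD).1) (fun C D CD => (mP C D CD).2)).
Qed.

Inductive amalg_rel (A : cstarAlgType R) (P : amalgams A) :
    forall C D : comSubalg A, P C -> P D -> Prop :=
| AmalgRel C D (CD : csub_set C `<=` csub_set D) x :
    @amalg_rel A P C D x (amalg_map P CD x).

Lemma colimit_exists (A : cstarAlgType R) (P : amalgams A) :
  exists (Q : cstarAlgType R) (leg : forall C, starHom (P C) Q),
    is_colimit leg.
Proof.
have [Q [leg [legP univ]]] := rel_colimit_exists (@amalg_rel A P).
exists Q, leg; split=> [C D CD x|M leg' leg'P]; first exact/esym/legP.
by apply: univ => _ _ _ _ [C D CD x]; exact/esym/leg'P.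
Qed.

(** The maps [L(C) -> L(f(C)) -> Q'] form a family compatible with [eta' \o f]. Any [D] containing
    [f(C)] may replace [f(C)], since [l'] respects inclusions. *)
Lemma universal_map (A B Q Q' : cstarAlgType R) (f : starHom A B)
    (eta : starHom A Q) (l : forall C : comSubalg A, starHom (ell C) Q)
    (eta' : starHom B Q') (l' : forall C : comSubalg B, starHom (ell C) Q') :
  is_universal eta l -> compatible_family eta' l' ->
  exists h : starHom Q Q', h \o eta =1 eta' \o f /\
    forall (C : comSubalg A) (D : comSubalg B)
      (fCD : forall x, csub_set C x -> csub_set D (f x)),
      h \o l C =1 l' D \o ell_map (csub_map fCD).
Proof.
move=> [_ univ] [l'_gelfand l'_incl].
have l'_map C D (fCD : forall x, csub_set C x -> csub_set D (f x)) :
    l' (img_sub f C) \o ell_map (csub_map (@img_subP R A B f C)) =1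
    l' D \o ell_map (csub_map fCD).
  move=> x /=; rewrite [LHS](l'_incl _ _ (img_sub_le fCD)) /=; congr (l' D _).
  by apply: ell_map_comp => y; exact: csub_inj.
have [|h [h_eta hl _]] := univ Q' (star_comp eta' f) (fun C =>
    star_comp (l' (img_sub f C)) (ell_map (csub_map (@img_subP R A B f C)))).
  split=> [C x|C D CD x] /=.
    rewrite [ell_map_fun _ _]ell_map_gelfand; exact: l'_gelfand.
  have CfD y : csub_set C y -> csub_set (img_sub f D) (f y).
    by move=> Cy; exists y => //; exact: CD.
  rewrite [LHS](l'_map _ _ CfD) /=; congr (l' _ _); apply/esym.
  by apply: ell_map_comp => y; exact: csub_inj.
exists h; split=> // C D fCD x.
by rewrite [LHS]hl [LHS](l'_map _ _ fCD).
Qed.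

Theorem colimFunctor_exists : inhabited (colimFunctor R).
Proof.
have am (A : cstarAlgType R) : amalgams A.
  by apply: inhabited_witness; exact: amalgams_exist.
have col A : {Q : cstarAlgType R & {leg : forall C, starHom (am A C) Q |
    is_colimit leg}}.
  by have /cid[Q /cid[leg legP]] := colimit_exists (am A); exists Q, leg.
pose Q A := projT1 (col A).
pose leg A : forall C, starHom (am A C) (Q A) := projT1 (projT2 (col A)).
have legP A : is_colimit (leg A) := projT2 (projT2 (col A)).
(* [eta] is read off at the least stage; the transition maps show that every other stage gives the
   same map. *)
pose eta A := star_comp (leg A (scalar_sub A)) (amalg_l (am A) (scalar_sub A)).
have etaE A C : leg A C \o amalg_l (am A) C =1 eta A.
  move=> x; rewrite /= -(amalg_map_l (am A) (@scalar_sub_le R A C)) /=.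
  exact: (legP A).1.
pose l A C := star_comp (leg A C) (amalg_r (am A) C).
have univ A : is_universal (eta A) (l A) := colimit_universal (legP A) (etaE A).
have map_ex A B (f : starHom A B) :=
  universal_map f (univ A) (univ B).1.
pose F A B f := projT1 (cid (map_ex A B f)).
have F_eta A B (f : starHom A B) : F A B f \o eta A =1 eta B \o f :=
  (projT2 (cid (map_ex A B f))).1.
have F_l A B (f : starHom A B) := (projT2 (cid (map_ex A B f))).2.
have F_id A : F A A (star_id A) =1 id.
  apply: (universal_hom_ext (h' := star_id (Q A)) (univ A)) => [x|C x].
    exact: F_eta.
  have idC y : csub_set C y -> csub_set C (star_id A y) by [].
  rewrite [LHS](F_l _ _ _ _ _ idC) /=; congr (l A C _).
  by apply: ell_map_id => y; exact: csub_inj.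
have F_comp A B C (g : starHom B C) (f : starHom A B) :
    F A C (star_comp g f) =1 F B C g \o F A B f.
  apply: (universal_hom_ext (h' := star_comp (F B C g) (F A B f)) (univ A)).
    by move=> x; rewrite [LHS]F_eta /= [F A B f _]F_eta [RHS]F_eta.
  (* [F_l] accepts any target containing the image of [S], so the iterated image [g(f(S))] serves
     for the composite as well. *)
  move=> S x; pose fS := @img_subP R A B f S.
  pose gfS := @img_subP R B C g (img_sub f S).
  have gfS' y : csub_set S y ->
      csub_set (img_sub g (img_sub f S)) (star_comp g f y).
    by move=> Sy; exact/gfS/fS.
  rewrite [LHS](F_l _ _ _ _ _ gfS') /=.
  rewrite [F A B f _](F_l _ _ _ _ _ fS) [RHS](F_l _ _ _ _ _ gfS) /=.
  congr (l C _ _); apply/esym.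
  by apply: ell_map_comp => y; exact: csub_inj.
split; apply: (@ColimFunctor R (@CstarFunctor R Q F F_id F_comp) am leg legP
  _ eta etaE) => A B f C D fC.
pose fCD := csub_image_sub fC.
have [|g [gl gr _]] := (amalg_pushout (am A) C).2 _
    (star_comp (amalg_l (am B) D) f)
    (star_comp (amalg_r (am B) D) (ell_map (csub_map fCD))).
  move=> x; apply: etrans ((amalg_pushout (am B) D).1 (csub_map fCD x)) _.
  by congr (amalg_r (am B) D _); exact/esym/ell_map_gelfand.
exists g; split=> //.
apply: (pushout_hom_ext (h := star_comp (F A B f) (leg A C))
  (h' := star_comp (leg B D) g) (amalg_pushout (am A) C)) => x.
  by rewrite /= [g _]gl [leg A C _]etaE [RHS]etaE; exact: F_eta.
by rewrite /= [g _]gr; exact: F_l.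
Qed.
End Existence.

(** * The universal property *)

Lemma starHom_eq (R : realType) (A B : cstarAlgType R) (f g : starHom A B) :
  f =1 g -> f = g.
Proof.
case: f g => [f l m s] [g l' m' s'] /= /funext fg.
by case: _ / fg in l' m' s' *; congr StarHom; apply: Prop_irrelevance.
Qed.

Lemma csub_commutative (R : realType) (A : cstarAlgType R) (C : comSubalg A) :
  is_commutative (csub_cstar C).
Proof.
by move=> x y; apply: csub_inj; exact: csub_comm (csubP x) (csubP y).
Qed.

Section ColimFunctor.
Context (R : realType) (F : colimFunctor R).
Implicit Types A B C : cstarAlgType R.

Lemma colim_universal A : is_universal (colim_eta F A) (@colim_ell R F A).
Proof. exact: colimit_universal (@colimP R F A) (@colim_etaE R F A). Qed.

Section Morphism.
Context A B (f : starHom A B).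

Lemma colim_fmap_eta : Defs.fmap F f \o colim_eta F A =1 colim_eta F B \o f.
Proof.
move=> x; have [g [gl _ gE]] := @colim_mapE R F A B f (scalar_sub A)
  (img_sub f (scalar_sub A)) erefl.
rewrite -[RHS](colim_etaE F (img_sub f (scalar_sub A))).
rewrite /= -(colim_etaE F (scalar_sub A) x).
by rewrite [LHS]gE /=; congr (colim_leg _ _ _); exact: gl.
Qed.

(** [colim_mapE] covers the case [D = f(C)]; the inclusion of [f(C)] into a larger [D] is absorbed
    by compatibility of the maps [colim_ell]. *)
Lemma colim_fmap_ell (C : comSubalg A) (D : comSubalg B)
    (fCD : forall x, csub_set C x -> csub_set D (f x)) :
  Defs.fmap F f \o colim_ell F C =1 colim_ell F D \o ell_map (csub_map fCD).
Proof.
move=> x; have [g [_ gr gE]] := @colim_mapE R F A B f C (img_sub f C) erefl.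
have [_ incl] := (colim_universal B).1.
rewrite [LHS]gE /= [g _]gr.
rewrite [LHS](incl _ _ (img_sub_le fCD)) /=; congr (colim_ell F D _).
by apply: ell_map_comp => y; exact: csub_inj.
Qed.

End Morphism.

(* When [C] is commutative, it is the largest element of its own poset of
   commutative subalgebras, so that the colimit is [C *_C L(C) = L(C)]. *)
Lemma colim_iso_exists C (cC : is_commutative C) :
  exists h : starHom (F C) (ell C),
    [/\ is_star_iso h, h \o colim_eta F C =1 gelfand C
      & forall S, h \o colim_ell F S =1 ell_map (csub_hom S)].
Proof.
have [[eta_gelfand ell_incl] univ] := colim_universal C.
have [|h [h_eta h_ell _]] := univ _ (gelfand C) (fun S => ell_map (csub_hom S)).
  split=> [S|S T ST x]; first exact: ell_map_gelfand.
  by apply/esym/ell_map_comp.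
exists h; split=> //.
(* The inverse: [L(C)] is identified with [L] of the top subalgebra, which maps canonically to
   [F(C)]. *)
pose k := star_comp (colim_ell F (full_sub cC)) (ell_map (to_full cC)).
exists k; split=> x; last first.
  rewrite [LHS]h_ell [LHS](ell_map_comp (h := star_id C))//.
  exact: ell_map_id.
apply: (universal_hom_ext (h := star_comp k h) (h' := star_id _)
  (colim_universal C)) => {x} [c|S x].
  rewrite /= [h _]h_eta [ell_map_fun _ _]ell_map_gelfand.
  exact: eta_gelfand.
have ST : csub_set S `<=` csub_set (full_sub cC) by [].
rewrite /= [h _]h_ell [RHS](ell_incl _ _ ST) /=; congr (colim_ell F _ _).
by apply: ell_map_comp => y; exact: csub_inj.
Qed.

Lemma colim_functorial_discretization :
  is_functorial_discretization (colim_eta F).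
Proof.
split=> [A B f x|]; first exact/esym/colim_fmap_eta.
pose iso C cC := projT1 (cid (@colim_iso_exists C cC)).
have isoP C cC : [/\ is_star_iso (iso C cC),
    iso C cC \o colim_eta F C =1 gelfand C
    & forall S, iso C cC \o colim_ell F S =1 ell_map (csub_hom S)].
  exact: projT2 (cid (@colim_iso_exists C cC)).
exists iso; split=> [C cC|C D cC cD f|C cC]; try by case: (isoP C cC).
have [_ C_eta C_ell] := isoP C cC; have [_ D_eta D_ell] := isoP D cD.
apply: (universal_hom_ext (h := star_comp (iso D cD) (Defs.fmap F f))
  (h' := star_comp (ell_map f) (iso C cC)) (colim_universal C)) => [x|S x] /=.
  rewrite [Defs.fmap F f _]colim_fmap_eta [LHS]D_eta [iso C cC _]C_eta.
  exact/esym/ell_map_gelfand.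
rewrite [Defs.fmap F f _](colim_fmap_ell (@img_subP R C D f S)) [LHS]D_ell.
rewrite [iso C cC _]C_ell [LHS](ell_map_comp (h := star_comp f (csub_hom S)))//.
exact/esym/ell_map_comp.
Qed.

End ColimFunctor.

(** * Characters, and uniqueness of natural transformations *)

Section Characters.
Context (R : realType).

Section CharacterHom.
Context (C : cstarAlgType R) (chi : spectrum C).
Fact char_hom_subproof (c : C) :
  (fun _ : unit => chi c) \in @bounded_fct R unit.
Proof. by apply/bounded_fctP; exists (cabs (chi c)) => _; rewrite cabsE. Qed.
Definition char_hom_fun (c : C) : cplx R := Linf (char_hom_subproof c).
Fact char_hom_linear : linear char_hom_fun.
Proof. by move=> k x y; apply: linfP => t; exact: char_linear. Qed.
Fact char_hom_monoid : monoid_morphism char_hom_fun.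
Proof.
split=> [|x y]; apply: linfP => t; [exact: (char_monoid chi).1|].
exact: (char_monoid chi).2.
Qed.
Fact char_hom_star : {morph char_hom_fun : x / star x}.
Proof. by move=> x; apply: linfP => t; exact: char_star. Qed.
Definition char_hom : starHom C (cplx R) :=
  StarHom char_hom_linear char_hom_monoid char_hom_star.
End CharacterHom.

Definition cplx_point : spectrum (cplx R) :=
  @Character R (cplx R) (fun z => linf_fun z tt) (fun _ _ _ => erefl)
    (conj erefl (fun _ _ => erefl)) (fun _ => erefl).

(** [chi] is the pullback of [cplx_point] along [char_hom chi], so values at characters can be
    computed in [L] of the complex numbers. *)
Lemma ell_map_char (C : cstarAlgType R) (chi : spectrum C) (g : ell C) :
  linf_fun (ell_map (char_hom chi) g) cplx_point = linf_fun g chi.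
Proof. by rewrite /=; congr (linf_fun g _); exact: spectrum_eq. Qed.

(** Every element of [cplx] is a multiple of 1, so [cplx_point] is its only character and a function
    on the spectrum is a single number. *)
Lemma gelfand_cplx_surj (g : ell (cplx R)) : exists z, g = gelfand (cplx R) z.
Proof.
have zP : (fun _ : unit => linf_fun g cplx_point) \in @bounded_fct R unit.
  apply/bounded_fctP; exists (cabs (linf_fun g cplx_point)) => _.
  by rewrite cabsE.
exists (Linf zP); apply: linfP => chi /=.
have -> : Linf zP = linf_fun g cplx_point *: (1 : cplx R).
  by apply: linfP => -[]; exact/esym/mulr1.
rewrite charZ (char_monoid chi).1 mulr1; congr (linf_fun g _).
apply: spectrum_eq => z; rewrite -[RHS]mulr1 -(char_monoid chi).1 -charZ.
by congr (char_fun chi _); apply: linfP => -[]; exact/esym/mulr1.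
Qed.

End Characters.

Section Uniqueness.
Context (R : realType) (F F' : cstarFunctor R).
Context (eta : forall A, starHom A (F A)) (eta' : forall A, starHom A (F' A)).
Hypothesis F_disc : is_functorial_discretization eta.
Hypothesis F'_disc : is_functorial_discretization eta'.

Lemma discretization_cplx_surj (x : F (cplx R)) : exists z, x = eta (cplx R) z.
Proof.
have [_ [iso [isoP _ isoE]]] := F_disc; have ccplx := @cplx_comm R.
have [k [isoK _]] := isoP _ ccplx.
have [z zE] := gelfand_cplx_surj (iso _ ccplx x); exists z.
by apply: (can_inj isoK); rewrite zE; exact/esym/isoE.
Qed.

(* An element of [F'(C) = L(C)] is determined by its values at the characters
   [C -> R[i]], and by naturality these are computed in [F'(R[i])], where
   everything comes from [R[i]]. *)
Lemma discretization_nat_unique (theta theta' : forall A, starHom (F A) (F' A))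
    (C : cstarAlgType R) :
  is_commutative C -> is_natural theta -> is_natural theta' ->
  (forall A, theta A \o eta A =1 eta' A) ->
  (forall A, theta' A \o eta A =1 eta' A) -> theta C =1 theta' C.
Proof.
move=> cC nat nat' thetaE theta'E x.
have [_ [iso [isoP iso_nat _]]] := F'_disc; have ccplx := @cplx_comm R.
have [k [isoK _]] := isoP C cC.
apply: (can_inj isoK); apply: linfP => chi.
rewrite -[LHS]ell_map_char -[RHS]ell_map_char.
have E := iso_nat _ _ cC ccplx (char_hom chi).
congr (linf_fun _ _); rewrite -[LHS]E -[RHS]E /=; congr (iso _ _ _).
rewrite -[LHS]nat -[RHS]nat' /=.
have [z ->] := discretization_cplx_surj (Defs.fmap F (char_hom chi) x).
by rewrite [LHS]thetaE [RHS]theta'E.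
Qed.

End Uniqueness.

(** * Transformations into other functorial discretizations *)

Section FunctorialUniversality.
Context (R : realType) (F : colimFunctor R).
Context (F' : cstarFunctor R) (eta' : forall A, starHom A (F' A)).
Hypothesis F'_disc : is_functorial_discretization eta'.

Lemma discretization_compatible : exists2 phi_ :
    forall A (C : comSubalg A), starHom (ell C) (F' A),
  forall A, compatible_family (eta' A) (phi_ A)
  & forall A B (f : starHom A B) (C : comSubalg A) (D : comSubalg B)
      (fCD : forall x, csub_set C x -> csub_set D (f x)),
    Defs.fmap F' f \o phi_ A C =1 phi_ B D \o ell_map (csub_map fCD).
Proof.
have [eta'_nat [iso [isoP iso_nat isoE]]] := F'_disc.
pose inv C cC := projT1 (cid (isoP C cC)).
have isoK C cC : cancel (iso C cC) (inv C cC) := (projT2 (cid (isoP C cC))).1.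
have invK C cC : cancel (inv C cC) (iso C cC) := (projT2 (cid (isoP C cC))).2.
have inv_nat C D cC cD (f : starHom C D) :
    Defs.fmap F' f \o inv C cC =1 inv D cD \o ell_map f.
  move=> x; apply: (can_inj (isoK D cD)); rewrite [LHS]iso_nat [RHS]invK /=.
  by rewrite invK.
have inv_gelfand C cC : inv C cC \o gelfand C =1 eta' C.
  by move=> x; apply: (can_inj (isoK C cC)); rewrite [LHS]invK [RHS]isoE.
pose phi_ A C := star_comp (Defs.fmap F' (csub_hom C))
  (inv (csub_cstar C) (@csub_commutative R A C)).
(* This naturality contains compatibility as the case of the identity of [A]. *)
have phi_nat A B (f : starHom A B) (C : comSubalg A) (D : comSubalg B)
      (fCD : forall x, csub_set C x -> csub_set D (f x)) :
    Defs.fmap F' f \o phi_ A C =1 phi_ B D \o ell_map (csub_map fCD).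
  move=> x; rewrite /= -[LHS]Defs.fmap_comp.
  have /= <- := inv_nat _ _ (@csub_commutative R A C)
    (@csub_commutative R B D) (csub_map fCD) x.
  rewrite -[RHS]Defs.fmap_comp; congr (Defs.fmap F' _ _).
  exact: starHom_eq.
exists phi_ => // A; split=> [C x|C D CD x].
  rewrite /= [inv _ _ _]inv_gelfand; exact: esym (eta'_nat _ _ (csub_hom C) x).
by rewrite -[RHS](phi_nat A A (star_id A)) /= fmap_id.
Qed.

Lemma colim_functorial_universal :
  exists theta : forall A, starHom (F A) (F' A),
    [/\ is_natural theta,
        forall A, theta A \o colim_eta F A =1 eta' A
      & forall theta' : (forall A, starHom (F A) (F' A)),
          is_natural theta' ->
          (forall A, theta' A \o colim_eta F A =1 eta' A) ->
          forall A, theta' A =1 theta A].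
Proof.
have [phi_ phiP phi_nat] := discretization_compatible.
have theta_ex A : exists theta : starHom (F A) (F' A),
    theta \o colim_eta F A =1 eta' A /\
    forall C, theta \o colim_ell F C =1 phi_ A C.
  have [theta [? ? _]] := (colim_universal F A).2 _ _ _ (phiP A).
  by exists theta.
pose theta A := projT1 (cid (theta_ex A)).
have theta_eta A : theta A \o colim_eta F A =1 eta' A :=
  (projT2 (cid (theta_ex A))).1.
have theta_ell A := (projT2 (cid (theta_ex A))).2.
have theta_nat : is_natural theta.
  move=> A B f.
  apply: (universal_hom_ext (h := star_comp (theta B) (Defs.fmap F f))
    (h' := star_comp (Defs.fmap F' f) (theta A))
    (colim_universal F A)) => [x|C x] /=.
    rewrite [Defs.fmap F f _]colim_fmap_eta [LHS]theta_eta.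
    rewrite [theta A _]theta_eta; exact: F'_disc.1.
  rewrite [Defs.fmap F f _](colim_fmap_ell F (@img_subP R A B f C)).
  rewrite [LHS]theta_ell [theta A _]theta_ell; exact/esym/phi_nat.
exists theta; split=> // theta' theta'_nat theta'_eta A.
apply: (universal_hom_ext (colim_universal F A)) => [x|C x].
  by rewrite [LHS]theta'_eta [RHS]theta_eta.
have cC := @csub_commutative R A C.
have fullC y : csub_set (full_sub cC) y -> csub_set C (csub_hom C y).
  by move=> _; exact: csubP.
(* [x] comes from the top subalgebra of [C], with [C] regarded as an algebra in its own right. Its
   image in [F(A)] is thus the image under [F] of the inclusion of an element of [F(C)], and
   naturality reduces the claim to the commutative algebra [C]. *)
have -> : x = ell_map (csub_map fullC) (ell_map (to_full cC) x).
  rewrite [RHS](ell_map_comp (h := star_id (csub_cstar C))) ?ell_map_id//.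
  by move=> y; exact: csub_inj.
have /= E := colim_fmap_ell F fullC (ell_map (to_full cC) x).
rewrite /= -E [LHS]theta'_nat [RHS]theta_nat /=; congr (Defs.fmap F' _ _).
have F_disc := colim_functorial_discretization F.
exact: (discretization_nat_unique F_disc F'_disc).
Qed.

End FunctorialUniversality.

Theorem theorem2p5 (R : realType) :
  inhabited (colimFunctor R) /\
  forall F : colimFunctor R,
  [/\ (* (a) *)
      is_functorial_discretization (colim_eta F),
      (* (b): eta_A is itself a compatible discretization; every compatible
         phi factors through eta_A, uniquely once the maps phi_C are given *)
      forall A : cstarAlgType R,
        compatible_family (colim_eta F A) (@colim_ell R F A) /\
        forall (M : cstarAlgType R) (phi : starHom A M),
          is_compatible_discretization phi ->
          (exists psi : starHom (F A) M, psi \o colim_eta F A =1 phi) /\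
          forall phi_ : (forall C : comSubalg A, starHom (ell C) M),
            compatible_family phi phi_ ->
            exists psi : starHom (F A) M,
              [/\ psi \o colim_eta F A =1 phi,
                  forall C : comSubalg A, psi \o colim_ell F C =1 phi_ C
                & forall psi' : starHom (F A) M,
                    psi' \o colim_eta F A =1 phi ->
                    (forall C : comSubalg A, psi' \o colim_ell F C =1 phi_ C) ->
                    psi' =1 psi]
    & (* (c) *)
      forall (F' : cstarFunctor R) (eta' : forall A, starHom A (F' A)),
        is_functorial_discretization eta' ->
        exists theta : forall A, starHom (F A) (F' A),
          [/\ is_natural theta,
              forall A, theta A \o colim_eta F A =1 eta' A
            & forall theta' : (forall A, starHom (F A) (F' A)),
                is_natural theta' ->
                (forall A, theta' A \o colim_eta F A =1 eta' A) ->
                forall A, theta' A =1 theta A]].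
Proof.
split; first exact: colimFunctor_exists.
move=> F; split; first exact: colim_functorial_discretization.
  move=> A; have [comp univ] := colim_universal F A; split=> // M phi phi_ex.
  split=> [|phi_ phiP]; last exact: univ.
  by have [phi_ /univ[psi [psi_eta _ _]]] := phi_ex; exists psi.
by move=> F' eta' disc; exact: colim_functorial_universal.
Qed.
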